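(* There exists a graph $G$ with the following two properties. 1) The graph $G$ has a drawing $\mathcal{D}$ on the torus with every pair of independent edges crossing an even number of times, and with a set $W$ of four vertices of $G$ such that every pair of edges with a common endpoint in $W$ crosses an even number of times. 2) There is no embedding of $G$ on the torus with the same cyclic orders of edges (rotations) at the vertices of $W$ as in $\mathcal{D}$.
   Context: Graphs are finite and have no multiple edges and no loops. The torus is the orientable closed surface of genus $1$. A drawing of a graph $G$ on a surface $S$ represents each vertex by a unique point of $S$ (distinct vertices by distinct points) and each edge $uv$ by a simple curve in $S$ joining the points that represent $u$ and $v$, such that no edge passes through a vertex, no two edges touch, every edge has only finitely many intersection points with other edges, and no three edges cross at the same inner point. In particular, every common point of two edges is either their common endpoint or a (transversal) crossing. The number of times two edges cross is the number of their common crossings (a common endpoint is not a crossing); zero counts as even. An embedding is a drawing in which no two edges cross. Two edges are independent if they do not share a vertex. The rotation of a vertex $v$ in a drawing on an orientable surface (with a fixed orientation) is the clockwise cyclic order of the edges incident to $v$. In property 2), the drawing $\mathcal{D}$ and the set $W$ are those from property 1). *)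

(* Defs.v *)
From HB Require Import structures.
From mathcomp Require Import all_boot all_order all_algebra.
From mathcomp Require Import all_classical all_reals all_analysis.

Set Implicit Arguments.
Unset Strict Implicit.
Unset Printing Implicit Defensive.
Import Order.TTheory GRing.Theory Num.Theory.
Import numFieldNormedType.Exports.

Local Open Scope classical_set_scope.
Local Open Scope ring_scope.
Local Open Scope quotient_scope.

Section Torus.
Context {R : realType}.

Definition lattice_rel : rel (R * R) :=
  fun x y => (x.1 - y.1 \is a Num.int) && (x.2 - y.2 \is a Num.int).

Lemma lattice_rel_refl : reflexive lattice_rel.
Proof. by move=> x; rewrite /lattice_rel !subrr rpred0. Qed.

Lemma lattice_rel_sym : symmetric lattice_rel.
Proof. by move=> x y; rewrite /lattice_rel -rpredN opprB -(rpredN _ (x.2 - y.2)) opprB. Qed.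

Lemma lattice_rel_trans : transitive lattice_rel.
Proof.
move=> y x z /andP[xy1 xy2] /andP[yz1 yz2]; apply/andP; split.
  by rewrite -(subrK y.1 x.1) -addrA rpredD.
by rewrite -(subrK y.2 x.2) -addrA rpredD.
Qed.

Definition lattice_equiv : equiv_rel (R * R) :=
  EquivRel _ lattice_rel_refl lattice_rel_sym lattice_rel_trans.

End Torus.

(* The torus is R^2 / Z^2 with the quotient topology; it is oriented by the
   standard orientation of the plane. *)
Definition torus (R : realType) : topologicalType :=
  quotient_topology {eq_quot (@lattice_equiv R)}.

Section LocalOrder.
Context {R : realType}.

Definition sqnorm (a : R * R) : R := a.1 ^+ 2 + a.2 ^+ 2.

(* p translated by the vector a; the result does not depend on the
   representative chosen for p. *)
Definition translate (p : torus R) (a : R * R) : torus R :=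
  \pi_(quotient_topology {eq_quot (@lattice_equiv R)}) (repr p + a).

(* The arc g, which starts at p at time 0, first leaves the open disc of radius
   r about p at the point p + a of its boundary circle (for r < 1/2 the closed
   disc is embedded in the torus, so that a is unique). *)
Definition exits_at (p : torus R) (r : R) (g : R -> torus R) (a : R * R) : Prop :=
  sqnorm a = r ^+ 2 /\
  exists s : R, [/\ 0 < s, g s = translate p a &
    forall t, 0 <= t < s -> exists2 b, sqnorm b < r ^+ 2 & g t = translate p b].

(* Three points of a circle are in clockwise order iff the triangle they span
   is negatively oriented. *)
Definition clockwise_points (a b c : R * R) : Prop :=
  (b.1 - a.1) * (c.2 - a.2) - (b.2 - a.2) * (c.1 - a.1) < 0.

(* Clockwise cyclic order, around p, of three arcs that start at p at time 0
   and are disjoint near p apart from p: the order in which they first meet any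
   sufficiently small circle about p. *)
Definition clockwise_arcs (p : torus R) (f g h : R -> torus R) : Prop :=
  \forall r \near (0 : R)^'+, exists a b c : R * R,
    [/\ exits_at p r f a, exits_at p r g b, exits_at p r h c &
        clockwise_points a b c].

Definition forward (g : R -> torus R) (s : R) : R -> torus R := fun t => g (s + t).
Definition backward (g : R -> torus R) (s : R) : R -> torus R := fun t => g (s - t).

(* The curves f and g pass through p at the inner times s and t, and the two
   halves of g leave p on different sides of f (as opposed to touching it). *)
Definition cross_at (p : torus R) (f : R -> torus R) (s : R)
    (g : R -> torus R) (t : R) : Prop :=
  [/\ 0 < s < 1, 0 < t < 1, f s = p, g t = p &
    (clockwise_arcs p (forward f s) (forward g t) (backward f s) /\
     clockwise_arcs p (backward f s) (backward g t) (forward f s)) \/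
    (clockwise_arcs p (forward f s) (backward g t) (backward f s) /\
     clockwise_arcs p (backward f s) (forward g t) (forward f s))].

Definition crossings (f g : R -> torus R) : set (torus R) :=
  [set p | exists s t, cross_at p f s g t].

Definition cross_evenly (f g : R -> torus R) : Prop :=
  exists n : nat, (crossings f g #= `I_(n.*2))%card.

Definition inner_points (g : R -> torus R) : set (torus R) :=
  [set g t | t in [set t | 0 < t < 1]].

Definition curve_points (g : R -> torus R) : set (torus R) :=
  [set g t | t in [set t | 0 <= t <= 1]].

End LocalOrder.

Definition distinct_edges (V : finType) (u v x y : V) : bool :=
  ~~ perm_eq [:: u; v] [:: x; y].

Definition independent_edges (V : finType) (u v x y : V) : bool :=
  [disjoint [:: u; v] & [:: x; y]].

(* A simple graph is given by its adjacency relation E. For E u v, the edge uv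
   is drawn as the restriction of [curve u v] to [0, 1], directed from u to v;
   values of [curve] elsewhere are irrelevant. *)
Record drawing (R : realType) (V : finType) (E : rel V) := Drawing {
  pos : V -> torus R ;
  curve : V -> V -> R -> torus R ;
  pos_inj : injective pos ;
  curve_continuous : forall u v, E u v ->
    {within [set t : R | 0 <= t <= 1], continuous (curve u v)} ;
  curve_simple : forall u v, E u v ->
    {in [pred t : R | 0 <= t <= 1] &, injective (curve u v)} ;
  curve_start : forall u v, E u v -> curve u v 0 = pos u ;
  curve_end : forall u v, E u v -> curve u v 1 = pos v ;
  curve_reverse : forall u v, E u v ->
    forall t : R, 0 <= t <= 1 -> curve v u t = curve u v (1 - t) ;
  curve_avoids_vertices : forall u v w, E u v ->
    ~ inner_points (curve u v) (pos w) ;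
  curves_finite : forall u v x y, E u v -> E x y -> distinct_edges u v x y ->
    finite_set (curve_points (curve u v) `&` curve_points (curve x y)) ;
  curves_no_touching : forall u v x y, E u v -> E x y -> distinct_edges u v x y ->
    inner_points (curve u v) `&` inner_points (curve x y)
      `<=` crossings (curve u v) (curve x y) ;
  curves_no_triple : forall u v x y z w, E u v -> E x y -> E z w ->
    distinct_edges u v x y -> distinct_edges u v z w -> distinct_edges x y z w ->
    inner_points (curve u v) `&` inner_points (curve x y)
      `&` inner_points (curve z w) = set0
}.

Section DrawingNotions.
Context {R : realType} {V : finType} {E : rel V}.
Implicit Type D : drawing R E.

Definition embedding D : Prop :=
  forall u v x y, E u v -> E x y -> distinct_edges u v x y ->
    crossings (curve D u v) (curve D x y) = set0.

(* The rotation at v, as a ternary cyclic order on the edges va, represented by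
   the neighbours a of v. *)
Definition rotation D (v a b c : V) : Prop :=
  [/\ E v a, E v b, E v c &
      clockwise_arcs (pos D v) (curve D v a) (curve D v b) (curve D v c)].

Definition same_rotation D D' (v : V) : Prop :=
  forall a b c, rotation D v a b c <-> rotation D' v a b c.

Definition independently_even D : Prop :=
  forall u v x y, E u v -> E x y -> independent_edges u v x y ->
    cross_evenly (curve D u v) (curve D x y).

Definition even_at D (w : V) : Prop :=
  forall a b, E w a -> E w b -> a != b ->
    cross_evenly (curve D w a) (curve D w b).

End DrawingNotions.

(* Main.v *)
(** The graph is K_{3,4}, and W is its class of four vertices of degree 3.  In
    the drawing below all four vertices w of W have the same rotation (a, b, c).

    Suppose that K_{3,4} is embedded in R^2 / Z^2 with these rotations.  Lift the
    tripod at each w to the plane; its three ends are fixed lifts of a, b, c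
    translated by a triple m(w) of lattice vectors.  For w <> w' the tripods
    form a theta graph, and the triangle m(w) - m(w') has twice signed area -1.
    This is because a graph formed by three arcs with the same rotation at both
    ends cuts the torus into a single disc; the proof integrates a closed
    1-cochain [area] of R^2 \ Z^2 (a discrete 4 x dy) over the boundary of the
    square (s, t) |-> alpha(s) - beta(t), for two arcs alpha and beta, with the
    two corners at the common ends cut off: the corners see the rotations, and
    the sides, summed over the three pairs of arcs, the area of the triangle.
    Now signed area is a quadratic form of signature (2, 2) on triples up to
    translation, whereas four points with all mutual values -1 span a negative
    definite space of dimension 3.

    Modulo 2 there is no contradiction (the field F_4 inside M_2(F_2) gives
    four such points), and this is how the drawing can exist. *)

Require Import Defs.
From mathcomp Require Import all_boot all_order all_algebra.
From mathcomp Require Import all_classical all_reals all_analysis.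
From mathcomp Require Import ring lra zify ssrZ.

Set Implicit Arguments.
Unset Strict Implicit.
Unset Printing Implicit Defensive.
Import Order.TTheory GRing.Theory Num.Theory.
Import numFieldNormedType.Exports.
Local Open Scope classical_set_scope.
Local Open Scope ring_scope.
Local Open Scope quotient_scope.

Lemma pair_ext (U V : Type) (z v : U * V) : z.1 = v.1 -> z.2 = v.2 -> z = v.
Proof. by case: z v => [? ?] [? ?] /= -> ->. Qed.

Lemma fstB (U V : zmodType) (z z' : U * V) : (z - z').1 = z.1 - z'.1.
Proof. by []. Qed.

Lemma sndB (U V : zmodType) (z z' : U * V) : (z - z').2 = z.2 - z'.2.
Proof. by []. Qed.

(** * The area cochain *)

Section DiscreteArea.
Context {R : realType}.
Implicit Types (x y d : R) (z : R * R).

(** A rounding of [2 * y] that is exact at integers and takes the value [2 * m + 1] on the whole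
    open interval from [m] to [m + 1]. It is odd and commutes with integer translations. *)
Definition hgt y : int := Num.floor y + Num.ceil y.

Lemma hgtN y : hgt (- y) = - hgt y.
Proof. by rewrite /hgt (floorNceil (- y)) (ceilNfloor (- y)) opprK opprD addrC. Qed.

Lemma hgtD y (m : int) : hgt (y + m%:~R) = hgt y + m *+ 2.
Proof.
rewrite /hgt floorDrz ?intr_int// ceilDrz ?intr_int//.
rewrite intrKfloor intrKceil.
by rewrite mulr2n addrACA.
Qed.

Lemma hgt_between y (m : int) : m%:~R < y < m%:~R + 1 -> hgt y = m *+ 2 + 1.
Proof.
move=> /andP[my ym].
have -> : hgt y = m + (m + 1).
  rewrite /hgt; congr (_ + _).
    by apply: floor_def; rewrite ltW//= intrD.
  by apply: ceil_def; rewrite addrK my intrD ltW.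
by ring.
Qed.

Lemma hgt_small y : `|y| < 1 -> hgt y = sgz y.
Proof.
rewrite ltr_norml => /andP[y1 y2]; case: (ltrgtP y 0) => y0.
- by rewrite ltr0_sgz// (@hgt_between _ (-1))// rmorphN1; apply/andP; split; lra.
- by rewrite gtr0_sgz// (@hgt_between _ 0)//; apply/andP; split; lra.
- by rewrite y0 sgz0 /hgt floor0 ceil0.
Qed.

Lemma hgt_near d y y' : (forall m : int, d <= `|y - m%:~R|) -> `|y' - y| < d ->
  hgt y' = hgt y.
Proof.
move=> dy; rewrite ltr_norml => /andP[yy1 yy2].
have := floor_itv y; set m := Num.floor y; rewrite intrD mulr1z => /andP[m1 m2].
have := dy m; rewrite ger0_norm ?subr_ge0// => d1.
have := dy (m + 1); rewrite intrD mulr1z ler0_norm ?subr_le0; [move=> d2|exact: ltW].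
by rewrite !(@hgt_between _ m)//; apply/andP; split; lra.
Qed.

Definition far d z := forall m n : int, d <= `|z.1 - m%:~R| \/ d <= `|z.2 - n%:~R|.

Definition step d z z' := `|z'.1 - z.1| < d /\ `|z'.2 - z.2| < d.

(* A piecewise constant version of the form 4 x dy: closed away from the lattice,
   and changed by lattice translations in a simple way. *)
Definition area z z' : int := (hgt z'.2 - hgt z.2) * hgt z.1.

Lemma areaN z z' : area (- z) (- z') = area z z'.
Proof. by rewrite /area !hgtN; ring. Qed.

Definition latv (u : int * int) : R * R := (u.1%:~R, u.2%:~R).

Lemma areaD z z' u :
  area (z + latv u) (z' + latv u) = area z z' + u.1 *+ 2 * (hgt z'.2 - hgt z.2).
Proof. by rewrite /area !hgtD; ring. Qed.

(** Away from the lattice, one coordinate of [z00] is at distance at least [2 * d] from all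
    integers. If it is the second, [hgt] of the second coordinate is constant on the square and all
    four terms vanish. If it is the first, the factor [hgt] of the first coordinate is constant and
    both sides telescope. *)
Lemma area_square d z00 z10 z01 z11 : far (d *+ 2) z00 ->
  step d z00 z10 -> step d z10 z11 -> step d z00 z01 -> step d z01 z11 ->
  area z00 z10 + area z10 z11 = area z00 z01 + area z01 z11.
Proof.
move=> F [a1 a2] [b1 b2] [c1 c2] [e1 e2].
have d0 : 0 < d by apply: le_lt_trans a1.
have two (s t u : R) : `|t - s| < d -> `|u - t| < d -> `|u - s| < d *+ 2.
  by rewrite !ltr_norml mulr2n => /andP[? ?] /andP[? ?]; apply/andP; split; lra.
have one (s t : R) : `|t - s| < d -> `|t - s| < d *+ 2.
  by move=> /lt_trans; apply; rewrite mulr2n ltrDl.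
have [[m xm]|nx] := pselect (exists m : int, `|z00.1 - m%:~R| < d *+ 2).
  have ny n : d *+ 2 <= `|z00.2 - n%:~R| by case: (F m n) => //; rewrite leNgt xm.
  rewrite /area (hgt_near ny (one _ _ a2)) (hgt_near ny (one _ _ c2)).
  by rewrite (hgt_near ny (two _ _ _ a2 b2)); ring.
have {}nx m : d *+ 2 <= `|z00.1 - m%:~R|.
  by rewrite leNgt; apply/negP => mx; apply: nx; exists m.
rewrite /area (hgt_near nx (one _ _ a1)) (hgt_near nx (one _ _ c1)); ring.
Qed.

(** * Stokes' theorem on a grid *)

Section Grid.
Variable F : nat -> nat -> R * R.

Definition harea k0 k1 l := \sum_(k0 <= k < k1) area (F k l) (F k.+1 l).
Definition varea k l0 l1 := \sum_(l0 <= l < l1) area (F k l) (F k l.+1).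

Lemma harea_cat k1 k0 k2 l : (k0 <= k1)%N -> (k1 <= k2)%N ->
  harea k0 k2 l = harea k0 k1 l + harea k1 k2 l.
Proof. by move=> *; rewrite /harea (big_cat_nat _ (n := k1)). Qed.

Lemma varea_cat l1 k l0 l2 : (l0 <= l1)%N -> (l1 <= l2)%N ->
  varea k l0 l2 = varea k l0 l1 + varea k l1 l2.
Proof. by move=> *; rewrite /varea (big_cat_nat _ (n := l1)). Qed.

(** Discrete Stokes theorem: the identities of the unit squares telescope along each row and then
    over the rows. *)
Lemma area_rectangle k0 k1 l0 l1 : (k0 <= k1)%N -> (l0 <= l1)%N ->
  (forall k l, (k0 <= k < k1)%N -> (l0 <= l < l1)%N ->
     area (F k l) (F k.+1 l) + area (F k.+1 l) (F k.+1 l.+1) =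
     area (F k l) (F k l.+1) + area (F k l.+1) (F k.+1 l.+1)) ->
  harea k0 k1 l0 + varea k1 l0 l1 = varea k0 l0 l1 + harea k0 k1 l1.
Proof.
move=> k01 l01 sq.
have row l : (l0 <= l < l1)%N ->
    harea k0 k1 l.+1 - harea k0 k1 l =
    area (F k1 l) (F k1 l.+1) - area (F k0 l) (F k0 l.+1).
  move=> ll; rewrite -(telescope_sumr (fun k => area (F k l) (F k l.+1)))//.
  rewrite /harea -sumrB; apply: eq_big_nat => k kk; have := sq k l kk ll; lia.
have := telescope_sumr (fun l => harea k0 k1 l) l01.
rewrite (eq_big_nat _ _ row) sumrB -/(varea _ _ _) -/(varea _ _ _); lia.
Qed.

(** The square with two opposite corners removed is cut into the rectangles [[p, n] x [0, p]],
    [[0, n] x [p, q]] and [[0, q] x [q, n]]. The eight terms are the sides of its boundary, those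
    traversed backwards being on the right. *)
Lemma area_cut_square p q n : (p <= q)%N -> (q <= n)%N ->
  (forall k l, (k < n)%N -> (l < n)%N -> ~~ ((k < p) && (l < p))%N ->
     ~~ ((q <= k) && (q <= l))%N ->
     area (F k l) (F k.+1 l) + area (F k.+1 l) (F k.+1 l.+1) =
     area (F k l) (F k l.+1) + area (F k l.+1) (F k.+1 l.+1)) ->
  harea p n 0 + varea n 0 q + harea 0 p p + varea q q n =
  varea p 0 p + varea 0 p n + harea q n q + harea 0 q n.
Proof.
move=> pq qn sq.
have := @area_rectangle p n 0 p (leq_trans pq qn) (leq0n _).
have := @area_rectangle 0 n p q (leq0n _) pq.
have := @area_rectangle 0 q q n (leq0n _) qn.
have sq1 k l : (0 <= k < q)%N -> (q <= l < n)%N ->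
  area (F k l) (F k.+1 l) + area (F k.+1 l) (F k.+1 l.+1) =
     area (F k l) (F k l.+1) + area (F k l.+1) (F k.+1 l.+1).
  by move=> *; apply: sq; lia.
have sq2 k l : (0 <= k < n)%N -> (p <= l < q)%N ->
  area (F k l) (F k.+1 l) + area (F k.+1 l) (F k.+1 l.+1) =
     area (F k l) (F k l.+1) + area (F k l.+1) (F k.+1 l.+1).
  by move=> *; apply: sq; lia.
have sq3 k l : (p <= k < n)%N -> (0 <= l < p)%N ->
  area (F k l) (F k.+1 l) + area (F k.+1 l) (F k.+1 l.+1) =
     area (F k l) (F k l.+1) + area (F k l.+1) (F k.+1 l.+1).
  by move=> *; apply: sq; lia.
move=> /(_ sq1) E1 /(_ sq2) E2 /(_ sq3) E3.
rewrite (@varea_cat p n 0 q)// (@varea_cat q 0 p n)//.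
move: E1 E2 E3; rewrite (@harea_cat p 0 n p) ?(leq_trans pq)//.
rewrite (@harea_cat q 0 n q)//.
set a1 := harea _ _ _; set a2 := varea _ _ _.
by clear; lia.
Qed.

End Grid.

(** * The area along the sides of a cut corner *)

Section Corners.

Definition hsign x : int := if 0 <= x then 1 else -1.

(* Up to terms that cancel when summed over a cyclic triple, the area of the
   path from [z] through [z - z'] to [- z']. *)
Definition turn z z' : int := (hsign z.1 + hsign z'.1) * sgz (z.2 - z'.2).

(** In the open half-plane with inner normal [n], the second coordinate can change sign only at the
    half of the horizontal axis on the side of [hsign n.1]; there [far] keeps the first coordinate
    away from zero. If [n.1 = 0], the sign does not change at all. *)
Lemma area_halfplane d n z z' :
  0 < n.1 * z.1 + n.2 * z.2 -> 0 < n.1 * z'.1 + n.2 * z'.2 ->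
  `|z.1| < 1 -> `|z.2| < 1 -> `|z'.2| < 1 ->
  far (d *+ 2) z -> step d z z' ->
  area z z' = hsign n.1 * (sgz z'.2 - sgz z.2).
Proof.
move=> nz nz' z1 z2 z'2 F [s1 s2]; rewrite /area (hgt_small z1) (hgt_small z2).
rewrite (hgt_small z'2).
have [->|ne] := eqVneq (sgz z'.2) (sgz z.2); first by rewrite !subrr mulr0 mul0r.
have d0 : 0 < d by apply: le_lt_trans s1.
have y0 : `|z.2| < d.
  rewrite ltNge; apply/negP => dz; move/negP: ne; apply.
  move: s2; rewrite ltr_norml => /andP[? ?].
  by move: dz; rewrite ler_normr => /orP[dz|dz]; [rewrite !gtr0_sgz//|rewrite !ltr0_sgz//]; lra.
have : d *+ 2 <= `|z.1|.
  have := F 0 0; rewrite !mulr0z !subr0 => -[//|]; rewrite mulr2n => dy; lra.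
rewrite mulr2n => x1; rewrite mulrC /hsign; congr (_ * _).
move: s1; rewrite ltr_norml => /andP[? ?]; case: ifP => n1.
- rewrite gtr0_sgz//; rewrite ltNge; apply/negP => x0; apply/negP: ne.
  rewrite negbK; move: (x1); rewrite ler0_norm// => x2.
  have a : 0 < n.2 * z.2 by nra.
  have a' : 0 < n.2 * z'.2 by nra.
  apply/eqP; case: (ltrgtP n.2 0) => n2; [|..|by move: a; rewrite n2 mul0r ltxx].
    by rewrite !ltr0_sgz//; nra.
  by rewrite !gtr0_sgz//; nra.
- rewrite ltr0_sgz//; rewrite ltNge; apply/negP => x0; apply/negP: ne.
  rewrite negbK; move: (x1); rewrite ger0_norm// => x2.
  move/negbT : n1; rewrite -ltNge => n1.
  have a : 0 < n.2 * z.2 by nra.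
  have a' : 0 < n.2 * z'.2 by nra.
  apply/eqP; case: (ltrgtP n.2 0) => n2; [|..|by move: a; rewrite n2 mul0r ltxx].
    by rewrite !ltr0_sgz//; nra.
  by rewrite !gtr0_sgz//; nra.
Qed.

Lemma sqnorm_le_coord z r : 0 <= r -> sqnorm z <= r ^+ 2 -> `|z.1| <= r /\ `|z.2| <= r.
Proof.
rewrite /sqnorm => r0 h; rewrite -(ger0_norm r0); split; rewrite -ler_sqr ?nnegrE//;
  rewrite -!normrX !ger0_norm ?sqr_ge0//.
  by apply: le_trans h; rewrite lerDl sqr_ge0.
by apply: le_trans h; rewrite lerDr sqr_ge0.
Qed.

Section CornerPath.
Variables (d r : R) (a : R * R) (v : nat -> R * R) (p q : nat).
Hypotheses (r0 : 0 <= r) (r_lt : r < 1 / 2).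
Hypothesis a_r : sqnorm a = r ^+ 2.
Hypothesis v_r : forall l, (p <= l <= q)%N -> sqnorm (v l) <= r ^+ 2.
Hypothesis v_far : forall l, (p <= l <= q)%N -> far (d *+ 2) (a - v l).
Hypothesis v_step : forall l, (p <= l < q)%N -> step d (v l) (v l.+1).

(** The point [a] is on a circle about the origin and the [v l] are in its disc, so the differences
    [a - v l] stay in the open half-plane with inner normal [a]. *)
Lemma corner_step l : (p <= l < q)%N ->
  [/\ area (a - v l) (a - v l.+1) =
        hsign a.1 * (sgz (a - v l.+1).2 - sgz (a - v l).2),
      hgt (a - v l).2 = sgz (a - v l).2 & hgt (a - v l.+1).2 = sgz (a - v l.+1).2].
Proof.
move=> /andP[pl lq].
have d0 : 0 < d.
  have [+ _] := v_step (introT andP (conj pl lq)); exact: le_lt_trans.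
have side k : (p <= k <= q)%N ->
    [/\ 0 < a.1 * (a - v k).1 + a.2 * (a - v k).2, `|(a - v k).1| < 1 & `|(a - v k).2| < 1].
  move=> pkq; have a_le : sqnorm a <= r ^+ 2 by rewrite a_r.
  have [ha1 ha2] := sqnorm_le_coord r0 a_le.
  have r_half := r_lt.
  have [hv1 hv2] := sqnorm_le_coord r0 (v_r pkq).
  have ne : 0 < ((a - v k).1) ^+ 2 + ((a - v k).2) ^+ 2.
    rewrite lt_neqAle addr_ge0 ?sqr_ge0// andbT eq_sym paddr_eq0 ?sqr_ge0//.
    rewrite !sqrf_eq0; apply/negP => /andP[/eqP e1 /eqP e2].
    have := v_far pkq 0 0; rewrite e1 e2 !mulr0z !subr0 normr0 mulr2n; lra.
  split.
  (* Since [|v k| <= |a|], the scalar product of [a] and [a - v k] is at least half of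
     [|a - v k| ^ 2]. *)
  - by move: ne a_r (v_r pkq); rewrite /sqnorm fstB sndB => ? ? ?; nra.
  - move: ha1 hv1; rewrite !ler_norml ltr_norml ?fstB ?sndB => /andP[h1 h2] /andP[h3 h4].
    by apply/andP; split; lra.
  - move: ha2 hv2; rewrite !ler_norml ltr_norml ?fstB ?sndB => /andP[? ?] /andP[? ?].
    by apply/andP; split; lra.
have pl1 : (p <= l <= q)%N by rewrite pl ltnW.
have pl2 : (p <= l.+1 <= q)%N by rewrite lq andbT ltnW.
have [h1 h2 h3] := side _ pl1; have [h1' h2' h3'] := side _ pl2.
split; [|exact: hgt_small|exact: hgt_small].
apply: (@area_halfplane d) => //; first exact: v_far.
have [s1 s2] := v_step (introT andP (conj pl lq)).
have eqB (x y t : R) : (x - y) - (x - t) = t - y by ring.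
by split; rewrite ?fstB ?sndB eqB distrC.
Qed.

Hypothesis pq : (p <= q)%N.

Lemma area_corner u :
  \sum_(p <= l < q) area (a - v l + latv u) (a - v l.+1 + latv u) =
  (hsign a.1 + u.1 *+ 2) * (sgz (a - v q).2 - sgz (a - v p).2).
Proof.
rewrite -(telescope_sumr (fun l => sgz (a - v l).2))// mulr_sumr.
apply: eq_big_nat => l pl; have [e1 e2 e3] := corner_step pl.
by rewrite areaD e1 e2 e3; ring.
Qed.

Lemma area_corner' u :
  \sum_(p <= l < q) area (v l - a + latv u) (v l.+1 - a + latv u) =
  (hsign a.1 - u.1 *+ 2) * (sgz (a - v q).2 - sgz (a - v p).2).
Proof.
rewrite -(telescope_sumr (fun l => sgz (a - v l).2))// mulr_sumr.
apply: eq_big_nat => l pl; have [e1 e2 e3] := corner_step pl.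
rewrite -(opprB a) -(opprB a (v l.+1)) areaD areaN e1.
have nN z : (- z).2 = - z.2 by [].
by rewrite !nN !hgtN e2 e3; ring.
Qed.

End CornerPath.
End Corners.

End DiscreteArea.

(** * The boundary sum for two arcs with common ends *)

Section Arcs.
Context {R : realType}.
Implicit Types (d : R) (z : R * R).

Lemma latvD (u v : int * int) : latv (R := R) (u + v) = latv u + latv v.
Proof. by rewrite /latv !intrD. Qed.

Lemma latvN (u : int * int) : latv (R := R) (- u) = - latv u.
Proof. by rewrite /latv !mulrNz. Qed.

Lemma latv0 : latv 0 = 0 :> R * R. Proof. by []. Qed.

Lemma farD d z u : far d z -> far d (z + latv u).
Proof.
have eqB (x : R) (m k : int) : x + m%:~R - k%:~R = x - (k - m)%:~R.
  by rewrite intrD mulrNz opprB addrA addrAC.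
by move=> F m k; have := F (m - u.1) (k - u.2); rewrite !eqB.
Qed.

Lemma farN d z : far d z -> far d (- z).
Proof.
have eqN (x : R) (m : int) : - x - m%:~R = - (x - (- m)%:~R).
  by rewrite mulrNz opprB addrC.
by move=> F m k; have := F (- m) (- k); rewrite !eqN !normrN.
Qed.

(** A sampled lift of an arc. The exit index [p] and the entry index [q] are shared by all arcs that
    are compared, so that the corners to be cut off the grid of differences are squares. *)
Record lifted_arc (P Q : R * R) (r s d : R) (p q n : nat) (z : nat -> R * R) (u : int * int)
  : Prop := Arc {
  arc_start : z 0 = P;
  arc_end : z n = Q + latv u;
  arc_near_start : forall k, (k <= p)%N -> sqnorm (z k - P) <= r ^+ 2;
  arc_exit : sqnorm (z p - P) = r ^+ 2;
  arc_near_end : forall k, (q <= k <= n)%N -> sqnorm (z k - (Q + latv u)) <= s ^+ 2;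
  arc_entry : sqnorm (z q - (Q + latv u)) = s ^+ 2;
  arc_step : forall k, (k < n)%N -> step d (z k) (z k.+1) }.

(** Two arcs with common ends cannot be apart near these ends, hence the two exempt squares of
    indices. The sides of the squares, at [p] and at [q], are not exempt: the boundary path runs
    along them. *)
Definition apart (d : R) (p q n : nat) (z z' : nat -> R * R) : Prop :=
  forall k l, (k <= n)%N -> (l <= n)%N ->
    ~~ ((k < p) && (l < p))%N -> ~~ ((q < k) && (q < l))%N -> far (d *+ 2) (z k - z' l).

Section TwoArcs.
Variables (P Q : R * R) (r s d : R) (p q n : nat).
Hypotheses (r0 : 0 <= r) (r_lt : r < 1 / 2) (s0 : 0 <= s) (s_lt : s < 1 / 2).
Hypotheses (pq : (p <= q)%N) (qn : (q <= n)%N).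

(* Collects the terms of the boundary sum that depend on a single arc. *)
Definition potential (z : nat -> R * R) (u : int * int) : int :=
  \sum_(p <= k < n) area (z k - P) (z k.+1 - P)
  - \sum_(0 <= k < q) area (z k - (Q + latv u)) (z k.+1 - (Q + latv u))
  + hsign (z p - P).1 * sgz (z p - P).2
  + hsign (z q - (Q + latv u)).1 * sgz (z q - (Q + latv u)).2
  + u.1 * (hgt (P - Q).2 - u.2) *+ 4.

Variables (z z' : nat -> R * R) (u u' : int * int).
Hypotheses (Z : lifted_arc P Q r s d p q n z u) (Z' : lifted_arc P Q r s d p q n z' u').
Hypothesis zz' : apart d p q n z z'.

Lemma step_sub_r v1 v2 v : step d v1 v2 -> step d (v1 - v) (v2 - v).
Proof.
have eqB (a b c : R) : (a - c) - (b - c) = a - b by ring.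
by move=> [h1 h2]; split; rewrite ?fstB ?sndB eqB.
Qed.

Lemma step_sub_l v1 v2 v : step d v1 v2 -> step d (v - v1) (v - v2).
Proof.
have eqB (a b c : R) : (c - a) - (c - b) = b - a by ring.
by move=> [h1 h2]; split; rewrite ?fstB ?sndB eqB distrC.
Qed.

Lemma arc_hgt_entry (z0 : nat -> R * R) u0 : lifted_arc P Q r s d p q n z0 u0 ->
  hgt (z0 q - (Q + latv u0)).2 = sgz (z0 q - (Q + latv u0)).2.
Proof.
move=> Z0; apply: hgt_small.
have [_ +] := sqnorm_le_coord s0 (arc_near_end Z0 (introT andP (conj (leqnn q) qn))).
by have s1 := s_lt; lra.
Qed.

(** Changes the reference point from the end of the arc itself to that of another arc. By [areaD]
    the change is a multiple of a height difference, which telescopes to the indices [0] and [q]. *)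
Lemma arc_shift (z0 : nat -> R * R) u0 v : lifted_arc P Q r s d p q n z0 u0 ->
  \sum_(0 <= k < q) area (z0 k - (Q + latv v)) (z0 k.+1 - (Q + latv v)) =
  \sum_(0 <= k < q) area (z0 k - (Q + latv u0)) (z0 k.+1 - (Q + latv u0))
  + (u0 - v).1 *+ 2 * (sgz (z0 q - (Q + latv u0)).2 - (hgt (P - Q).2 - u0.2 *+ 2)).
Proof.
move=> Z0.
have e w : w - (Q + latv v) = w - (Q + latv u0) + latv (u0 - v).
  by rewrite latvD latvN !opprD !addrA subrK.
have h0 : hgt (z0 0%N - (Q + latv u0)).2 = hgt (P - Q).2 - u0.2 *+ 2.
  have -> : (z0 0%N - (Q + latv u0)).2 = (P - Q).2 + (- u0.2)%:~R.
    by rewrite (arc_start Z0) opprD addrA -latvN.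
  by rewrite hgtD mulNrn.
rewrite -(arc_hgt_entry Z0) -h0.
rewrite -(telescope_sumr (fun k => hgt (z0 k - (Q + latv u0)).2))//.
rewrite mulr_sumr -big_split /=; apply: eq_bigr => k _.
by rewrite (e (z0 k)) (e (z0 k.+1)) areaD.
Qed.

(** Stokes' theorem for the grid of differences [z k - z' l], with the corners at the two common
    ends cut off. Of the eight sides, the four long ones involve a single arc and an end point, and
    make up the potentials; the four short ones are corner paths and make up the turns. *)
Lemma area_two_arcs :
  potential z u - potential z' u' - (u.1 * u'.2 - u'.1 * u.2) *+ 4 =
  turn (z p - P) (z' p - P) + turn (z q - (Q + latv u)) (z' q - (Q + latv u')).
Proof.
have sq k l : (k < n)%N -> (l < n)%N -> ~~ ((k < p) && (l < p))%N ->
    ~~ ((q <= k) && (q <= l))%N ->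
    area (z k - z' l) (z k.+1 - z' l) + area (z k.+1 - z' l) (z k.+1 - z' l.+1) =
    area (z k - z' l) (z k - z' l.+1) + area (z k - z' l.+1) (z k.+1 - z' l.+1).
  move=> kn ln h1 h2.
  apply: (@area_square R d (z k - z' l) (z k.+1 - z' l) (z k - z' l.+1) (z k.+1 - z' l.+1)).
  - by refine (zz' (ltnW kn) (ltnW ln) h1 _); apply: contra h2 => /andP[? ?];
      apply/andP; split; exact: ltnW.
  - exact/step_sub_r/(arc_step Z).
  - exact/step_sub_l/(arc_step Z').
  - exact/step_sub_l/(arc_step Z').
  - exact/step_sub_r/(arc_step Z).
have := @area_cut_square _ (fun k l => z k - z' l) p q n pq qn sq; rewrite /harea /varea /=.
have pn := leq_trans pq qn.
under eq_bigr do rewrite (arc_start Z').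
rewrite (_ : \sum_(p <= l < n) area (z 0%N - z' l) (z 0%N - z' l.+1) =
  \sum_(p <= k < n) area (z' k - P) (z' k.+1 - P)); last first.
  by apply: eq_bigr => l _; rewrite (arc_start Z) -areaN !opprB.
rewrite (_ : \sum_(0 <= l < q) area (z n - z' l) (z n - z' l.+1) =
  \sum_(0 <= k < q) area (z' k - (Q + latv u)) (z' k.+1 - (Q + latv u))); last first.
  by apply: eq_bigr => l _; rewrite (arc_end Z) -areaN !opprB.
under [X in _ = _ + X]eq_bigr do rewrite (arc_end Z').
(* Two long sides refer each arc to the end of the other one. Referring it to its own end produces
   the mixed terms in [u] and [u']. *)
rewrite (arc_shift u Z') (arc_shift u' Z).
have eP v w : v - w = (v - P) - (w - P) + latv 0.
  by rewrite latv0 addr0 opprB addrA subrK.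
have eQ v w : v - w = (v - (Q + latv u)) - (w - (Q + latv u')) + latv (u - u').
  rewrite latvD latvN; set a := latv u; set b := latv u'.
  by apply/eqP; rewrite xpair_eqE; apply/andP; split; apply/eqP => /=; ring.
rewrite (_ : \sum_(0 <= k < p) area (z k - z' p) (z k.+1 - z' p) =
  hsign (z' p - P).1 * (sgz ((z' p - P) - (z p - P)).2 - sgz (z' p - P).2)); last first.
  under eq_bigr do rewrite (eP (z _)) (eP (z _.+1)).
  rewrite (@area_corner' _ d r)//.
  - by rewrite (arc_start Z) subrr !subr0.
  - exact: arc_exit Z'.
  - by move=> l /andP[_ lp]; exact: arc_near_start Z _ lp.
  - move=> l /andP[_ lp]; rewrite -opprB; apply: farN; rewrite opprB addrA subrK.
    by apply: zz' => //; lia.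
  - by move=> l /andP[_ lp]; apply/step_sub_r/(arc_step Z); lia.
rewrite (_ : \sum_(0 <= l < p) area (z p - z' l) (z p - z' l.+1) =
  hsign (z p - P).1 * (sgz ((z p - P) - (z' p - P)).2 - sgz (z p - P).2)); last first.
  under eq_bigr do rewrite (eP _ (z' _)) (eP _ (z' _.+1)).
  rewrite (@area_corner _ d r)//.
  - by rewrite (arc_start Z') subrr !subr0 ?addr0; congr (_ * _).
  - exact: arc_exit Z.
  - by move=> l /andP[_ lp]; exact: arc_near_start Z' _ lp.
  - by move=> l /andP[_ lp]; rewrite opprB addrA subrK; apply: zz' => //; lia.
  - by move=> l /andP[_ lp]; apply/step_sub_r/(arc_step Z'); lia.
have fQ v w : far (d *+ 2) (v - w) -> far (d *+ 2) (v - (Q + latv u) - (w - (Q + latv u'))).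
  by rewrite (eQ v w) => /(farD (- (u - u'))); rewrite latvN addrK.
rewrite (_ : \sum_(q <= l < n) area (z q - z' l) (z q - z' l.+1) =
  (hsign (z q - (Q + latv u)).1 + (u - u').1 *+ 2) * (sgz (z q - (Q + latv u)).2 -
   sgz ((z q - (Q + latv u)) - (z' q - (Q + latv u'))).2)); last first.
  under eq_bigr do rewrite (eQ _ (z' _)) (eQ _ (z' _.+1)).
  rewrite (@area_corner _ d s)//.
  - by rewrite (arc_end Z') subrr !subr0.
  - exact: arc_entry Z.
  - exact: arc_near_end Z'.
  - by move=> l /andP[ql ln]; apply/fQ/zz' => //; lia.
  - by move=> l /andP[_ lp]; apply/step_sub_r/(arc_step Z'); lia.
rewrite (_ : \sum_(q <= k < n) area (z k - z' q) (z k.+1 - z' q) =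
  (hsign (z' q - (Q + latv u')).1 - (u - u').1 *+ 2) * (sgz (z' q - (Q + latv u')).2 -
   sgz ((z' q - (Q + latv u')) - (z q - (Q + latv u))).2)); last first.
  under eq_bigr do rewrite (eQ (z _)) (eQ (z _.+1)).
  rewrite (@area_corner' _ d s)//.
  - by rewrite (arc_end Z) subrr !subr0.
  - exact: arc_entry Z'.
  - exact: arc_near_end Z.
  - by move=> l /andP[ql ln]; rewrite -opprB; apply/farN/fQ/zz' => //; lia.
  - by move=> l /andP[_ lp]; apply/step_sub_r/(arc_step Z); lia.
rewrite /potential /turn !(sndB (_ - _) (_ - _)).
rewrite -(opprB (z p - P).2) sgzN -(opprB (z q - (Q + latv u)).2) sgzN.
rewrite !(fstB u) !(fstB u') => /eqP; rewrite -subr_eq0 => E; apply/eqP.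
by rewrite -subr_eq0; move: E; congr (_ == 0); ring.
Qed.

End TwoArcs.

End Arcs.

(** * Rotations at the common ends, and the area of a theta graph *)

Section Turning.
Context {R : realType}.
Implicit Types (x : R) (z : R * R).

Lemma hsignP x : (hsign x = 1 /\ 0 <= x) \/ (hsign x = -1 /\ x < 0).
Proof. by rewrite /hsign; case: ifP => [|/negbT]; [left|rewrite -ltNge; right]. Qed.

Lemma hsign_ge0 x : 0 <= x -> hsign x = 1.
Proof. by rewrite /hsign => ->. Qed.

Lemma hsign_lt0 x : x < 0 -> hsign x = -1.
Proof. by rewrite /hsign leNgt => ->. Qed.

(* On a circle, the point whose second coordinate is in the middle lies beyond
   the chord spanned by the other two, on the side given by its first coordinate. *)
Lemma circle_middle r z1 z2 z3 :
  sqnorm z1 = r -> sqnorm z2 = r -> sqnorm z3 = r -> z3.2 < z2.2 -> z2.2 < z1.2 ->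
  (hsign z2.1 = 1 /\ ~ clockwise_points z3 z2 z1) \/
  (hsign z2.1 = -1 /\ ~ clockwise_points z1 z2 z3).
Proof.
rewrite /sqnorm /clockwise_points; case: z1 z2 z3 => [a1 a2] [b1 b2] [c1 c2] /=.
move=> ea eb ec cb ba.
(* At height [b2] the chord between the other two points has first coordinate [m / (a2 - c2)]. It is
   inside the circle there, so this is less than [|b1|] in absolute value. *)
pose m := (b2 - c2) * a1 + (a2 - b2) * c1.
have m_lt : m ^+ 2 < ((a2 - c2) * b1) ^+ 2.
  rewrite -subr_gt0 (_ : _ - _ = (b2 - c2) * (a2 - b2) * ((a1 - c1) ^+ 2 + (a2 - c2) ^+ 2)).
    apply: mulr_gt0; first by apply: mulr_gt0; rewrite subr_gt0.
    by rewrite ltr_wpDl ?sqr_ge0// exprn_gt0// subr_gt0 (lt_trans cb).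
  have h : (a2 - c2) * ((a2 - c2) * (b1 ^+ 2 + b2 ^+ 2 - r) - (b2 - c2) * (a1 ^+ 2 + a2 ^+ 2 - r)
      - (a2 - b2) * (c1 ^+ 2 + c2 ^+ 2 - r)) = 0.
    by rewrite ea eb ec !subrr; ring.
  by apply/eqP; rewrite -subr_eq0 -h /m; apply/eqP; ring.
have ac : 0 < a2 - c2 by rewrite subr_gt0 (lt_trans cb).
case: (hsignP b1) => -[-> b0]; [left|right]; split => //; apply/negP; rewrite -leNgt.
  have : m <= (a2 - c2) * b1.
    apply: le_trans (ler_norm _) _.
    rewrite -[leRHS]ger0_norm; last by apply: mulr_ge0; rewrite ?b0// ltW.
    by rewrite -ler_sqr ?nnegrE// !real_normK ?num_real// ltW.
  rewrite /m; nra.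
have : (a2 - c2) * b1 <= m.
  rewrite -[m]opprK lerNr; apply: le_trans (ler_norm _) _; rewrite normrN.
  rewrite -[leRHS]ger0_norm; last by rewrite oppr_ge0 pmulr_rle0// ltW.
  by rewrite normrN -ler_sqr ?nnegrE// !real_normK ?num_real// ltW.
rewrite /m; nra.
Qed.

Lemma clockwise_rot z1 z2 z3 : clockwise_points z1 z2 z3 -> clockwise_points z2 z3 z1.
Proof. by rewrite /clockwise_points => h; nra. Qed.

(** If the heights are distinct, the terms of the highest and the lowest point cancel, and the
    middle point contributes twice its [hsign], up to a sign that depends on the order of the
    heights. By [circle_middle], the clockwise order makes the result positive. Equal heights are
    treated by [level]. *)
Lemma turn_clockwise r z1 z2 z3 :
  sqnorm z1 = r -> sqnorm z2 = r -> sqnorm z3 = r -> clockwise_points z1 z2 z3 ->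
  turn z1 z2 + turn z2 z3 + turn z3 z1 = 2.
Proof.
move=> e1 e2 e3 cw.
have cw2 := clockwise_rot cw; have cw3 := clockwise_rot cw2.
have level (y1 y2 y3 : R * R) : sqnorm y1 = r -> sqnorm y2 = r -> sqnorm y3 = r ->
    clockwise_points y1 y2 y3 -> y1.2 = y2.2 -> turn y1 y2 + turn y2 y3 + turn y3 y1 = 2.
  rewrite /sqnorm /clockwise_points /turn => f1 f2 f3 cwy e12.
  (* Two points of a circle at the same height are mirror images or equal, and equal ones would span
     a degenerate triangle. *)
  have h : y1.1 = - y2.1.
    have /eqP : y1.1 ^+ 2 = y2.1 ^+ 2.
      by apply: (@addIr _ (y1.2 ^+ 2)); rewrite f1 e12 f2.
    rewrite eqf_sqr => /orP[/eqP e|/eqP//]; move: cwy; rewrite e e12 !subrr !mul0r subr0.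
    by rewrite ltxx.
  move: cwy; rewrite h e12 subrr sgz0 mul0r subr0 mulr0 add0r => cwy.
  have [y23|y23|y23] := ltrgtP y2.2 y3.2; last by rewrite y23 subrr mulr0 ltxx in cwy.
    rewrite ltr0_sgz ?subr_lt0// gtr0_sgz ?subr_gt0//.
    have y0 : y2.1 < 0 by nra.
    by rewrite (hsign_lt0 y0) (@hsign_ge0 (- y2.1)) ?oppr_ge0 1?ltW//; ring.
  rewrite gtr0_sgz ?subr_gt0// ltr0_sgz ?subr_lt0//.
  have y0 : 0 < y2.1 by nra.
  by rewrite (hsign_ge0 (ltW y0)) (@hsign_lt0 (- y2.1)) ?oppr_lt0//; ring.
have [l12|l12|l12] := ltrgtP z1.2 z2.2; last exact: level.
- have [l23|l23|l23] := ltrgtP z2.2 z3.2; last by rewrite -addrA addrC; apply: level.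
  + have := circle_middle e3 e2 e1 l12 l23 => -[[h nc]|[h nc]] //; rewrite /turn h.
    by rewrite (@gtr0_sgz _ (z3.2 - _)) ?subr_gt0 ?(lt_trans l12)// !ltr0_sgz ?subr_lt0//; ring.
  + have [l31|l31|l31] := ltrgtP z3.2 z1.2; last by rewrite addrC addrA; apply: level.
    * have := circle_middle e2 e1 e3 l31 l12 => -[[h nc]|[h nc]] //; rewrite /turn h.
      by rewrite (@gtr0_sgz _ (z2.2 - _)) ?subr_gt0// !ltr0_sgz ?subr_lt0//; ring.
    * have := circle_middle e2 e3 e1 l31 l23 => -[[h nc]|[h nc]] //; rewrite /turn h.
      by rewrite (@ltr0_sgz _ (z1.2 - _)) ?subr_lt0// !gtr0_sgz ?subr_gt0//; ring.
- have [l23|l23|l23] := ltrgtP z2.2 z3.2; last by rewrite -addrA addrC; apply: level.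
  + have [l31|l31|l31] := ltrgtP z3.2 z1.2; last by rewrite addrC addrA; apply: level.
    * have := circle_middle e1 e3 e2 l23 l31 => -[[h nc]|[h nc]] //; rewrite /turn h.
      by rewrite (@gtr0_sgz _ (z1.2 - _)) ?subr_gt0// !ltr0_sgz ?subr_lt0//; ring.
    * have := circle_middle e3 e1 e2 l12 l31 => -[[h nc]|[h nc]] //; rewrite /turn h.
      by rewrite (@ltr0_sgz _ (z2.2 - _)) ?subr_lt0// !gtr0_sgz ?subr_gt0//; ring.
  + have := circle_middle e1 e2 e3 l23 l12 => -[[h nc]|[h nc]] //; rewrite /turn h.
    by rewrite (@ltr0_sgz _ (z3.2 - _)) ?subr_lt0 ?(lt_trans l23)// !gtr0_sgz ?subr_gt0//; ring.
Qed.

(* Twice the signed area of the triangle [u1 u2 u3]. *)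
Definition cross_sum (u1 u2 u3 : int * int) : int :=
  (u1.1 * u2.2 - u2.1 * u1.2) + (u2.1 * u3.2 - u3.1 * u2.2) + (u3.1 * u1.2 - u1.1 * u3.2).

(** When [area_two_arcs] is summed over the three cyclic pairs, the potentials cancel and each end
    contributes 2, which leaves [-4 * cross_sum u1 u2 u3 = 4]. *)
Lemma cross_sum_three_arcs (P Q : R * R) (r s d : R) p q n
    (z1 z2 z3 : nat -> R * R) u1 u2 u3 :
  0 <= r < 1 / 2 -> 0 <= s < 1 / 2 -> (p <= q <= n)%N ->
  lifted_arc P Q r s d p q n z1 u1 -> lifted_arc P Q r s d p q n z2 u2 ->
  lifted_arc P Q r s d p q n z3 u3 ->
  apart d p q n z1 z2 -> apart d p q n z2 z3 -> apart d p q n z3 z1 ->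
  clockwise_points (z1 p - P) (z2 p - P) (z3 p - P) ->
  clockwise_points (z1 q - (Q + latv u1)) (z2 q - (Q + latv u2)) (z3 q - (Q + latv u3)) ->
  cross_sum u1 u2 u3 = -1.
Proof.
move=> /andP[r0 r_lt] /andP[s0 s_lt] /andP[pq qn] Z1 Z2 Z3 z12 z23 z31 cwP cwQ.
have tP := turn_clockwise (arc_exit Z1) (arc_exit Z2) (arc_exit Z3) cwP.
have tQ := turn_clockwise (arc_entry Z1) (arc_entry Z2) (arc_entry Z3) cwQ.
have := area_two_arcs r0 r_lt s0 s_lt pq qn Z1 Z2 z12.
have := area_two_arcs r0 r_lt s0 s_lt pq qn Z2 Z3 z23.
have := area_two_arcs r0 r_lt s0 s_lt pq qn Z3 Z1 z31.
move=> E3 E2 E1; rewrite /cross_sum; lia.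
Qed.

End Turning.

(** * Signed area as a quadratic form *)

Section PairwiseUnitAreas.

Let q (x1 x2 y1 y2 : int) := x1 * y2 - x2 * y1.

(* [q] has signature (2, 2), so a three-dimensional space contains a nonzero
   vector of the form on which [q >= 0]. *)
Lemma no_negative_triple (x1 x2 y1 y2 : 'I_3 -> int) :
  (forall i, q (x1 i) (x2 i) (y1 i) (y2 i) = -1) ->
  (forall i j, i != j ->
     q (x1 i - x1 j) (x2 i - x2 j) (y1 i - y1 j) (y2 i - y2 j) = -1) -> False.
Proof.
move=> q1 q2.
pose c (f : 'I_3 -> int) (l : int * int * int) :=
  l.1.1 * f 0 + l.1.2 * f 1 + l.2 * f 2.
(* The polar form [q v + q w - q (v - w)] is also -1 on each pair of the three vectors, which
   determines [q] on all their combinations. *)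
have qc l : q (c x1 l) (c x2 l) (c y1 l) (c y2 l) =
    - (l.1.1 ^+ 2 + l.1.2 ^+ 2 + l.2 ^+ 2 + l.1.1 * l.1.2 + l.1.2 * l.2 + l.1.1 * l.2).
  pose Q i := q (x1 i) (x2 i) (y1 i) (y2 i).
  pose P i j := q (x1 i - x1 j) (x2 i - x2 j) (y1 i - y1 j) (y2 i - y2 j).
  rewrite (_ : q _ _ _ _ = l.1.1 ^+ 2 * Q 0 + l.1.2 ^+ 2 * Q 1 + l.2 ^+ 2 * Q 2
    + l.1.1 * l.1.2 * (Q 0 + Q 1 - P 0 1) + l.1.2 * l.2 * (Q 1 + Q 2 - P 1 2)
    + l.1.1 * l.2 * (Q 0 + Q 2 - P 0 2)); last by rewrite /q /c /P /Q /q; ring.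
  by rewrite /Q /P !q1 !q2//; ring.
(* Under these two equations [q] is a sum of two squares. By [qc], on the other hand, [-2 * q] is
   [a ^ 2 + b ^ 2 + e ^ 2 + (a + b + e) ^ 2]. *)
have l0 l : c x1 l = c y2 l -> c y1 l = - c x2 l -> l = (0, 0, 0).
  move=> e1 e2; have := qc l; rewrite /q e1 e2; case: l {e1 e2} => [[a b] e] /= h.
  have {}h : a ^+ 2 + b ^+ 2 + e ^+ 2 + (a + b + e) ^+ 2 <= 0 by nia.
  have z (t : int) : t ^+ 2 <= 0 -> t = 0.
    by move=> t0; apply/eqP; rewrite -sqrf_eq0 eq_le t0 sqr_ge0.
  have [[[a2 b2] e2] s2] := (sqr_ge0 a, sqr_ge0 b, sqr_ge0 e, sqr_ge0 (a + b + e)).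
  by congr (_, _, _); apply: z; lra.
pose f i := x1 i - y2 i; pose g i := y1 i + x2 i.
have {}l0 a b e : a * f 0 + b * f 1 + e * f 2 = 0 -> a * g 0 + b * g 1 + e * g 2 = 0 ->
    [/\ a = 0, b = 0 & e = 0].
  rewrite /f /g => h1 h2; suff [-> -> ->] : (a, b, e) = (0, 0, 0) by [].
  by apply: l0; rewrite /c /=; lra.
(* Two linear forms on a three-dimensional space have a common nonzero zero, against [l0]. First the
   cross product of [f] and [g] is such a zero, so it vanishes; then vectors such as
   [(f 2, 0, - f 0)] are, so [f] and [g] vanish; then [(1, 0, 0)] is. *)
have [k0 k1 k2] : [/\ f 1 * g 2 - f 2 * g 1 = 0, f 2 * g 0 - f 0 * g 2 = 0
    & f 0 * g 1 - f 1 * g 0 = 0] by apply: l0; ring.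
have [f2 _ _] : [/\ f 2 = 0, 0 = 0 :> int & - f 0 = 0] by apply: l0; lia.
have [f1 f0 _] : [/\ f 1 = 0, - f 0 = 0 & 0 = 0 :> int] by apply: l0; lia.
have [g2 _ _] : [/\ g 2 = 0, 0 = 0 :> int & - g 0 = 0] by apply: l0; lia.
have [g1 g0 _] : [/\ g 1 = 0, - g 0 = 0 & 0 = 0 :> int] by apply: l0; lia.
by have [] : [/\ 1 = 0 :> int, 0 = 0 :> int & 0 = 0 :> int] by apply: l0; lia.
Qed.

(** The area of a triangle is [q] of two of its side vectors, which are unchanged by translation.
    Relative to the member [ord0], the other three form an excluded triple. *)
Lemma no_unit_quadruple (u : 'I_4 -> 'I_3 -> int * int) :
  ~ (forall i j, i != j ->
       cross_sum (u i 0 - u j 0) (u i 1 - u j 1) (u i 2 - u j 2) = -1).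
Proof.
move=> h.
pose v (i : 'I_3) x := u (lift ord0 i) x - u ord0 x.
apply: (@no_negative_triple (fun i => (v i 0 - v i 1).1) (fun i => (v i 0 - v i 1).2)
  (fun i => (v i 1 - v i 2).1) (fun i => (v i 1 - v i 2).2)) => [i|i j ij].
  have <- := h (lift ord0 i) ord0 isT; rewrite /v /q /cross_sum !fstB !sndB; ring.
have <- := h (lift ord0 i) (lift ord0 j) (_ : _ != _); last by rewrite (inj_eq lift_inj).
rewrite /v /q /cross_sum !fstB !sndB; ring.
Qed.

End PairwiseUnitAreas.

(** * Curves on the torus and their discrete lifts *)

Section TorusPoints.
Context {R : realType}.
Implicit Types (x y d : R) (z v : R * R) (p q : torus R).

Definition proj z : torus R := \pi_(quotient_topology {eq_quot (@lattice_equiv R)}) z.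

Lemma proj_repr p : proj (repr p) = p.
Proof. exact: reprK. Qed.

Lemma projP z z' : proj z = proj z' <-> exists u, z = z' + latv u.
Proof.
have e : (proj z = proj z') <-> lattice_rel z z'.
  split=> [/eqmodP//|h]; exact/eqmodP.
rewrite e /lattice_rel; split.
  move=> /andP[/intrP[m hm] /intrP[n hn]]; exists (m, n).
  case: z z' hm hn {e} => [a b] [a' b'] /= hm hn.
  by congr (_, _); rewrite /= -?hm -?hn addrC subrK.
by move=> [u ->]; rewrite /= [_ + _ - _]addrC addKr [_ + _ - _]addrC addKr !intr_int.
Qed.

Lemma translate_proj z v : translate (proj z) v = proj (z + v).
Proof.
rewrite /translate -/(proj _).
have [u ->] : exists u, repr (proj z) = z + latv u by apply/projP; rewrite proj_repr.
by apply/projP; exists u; rewrite addrAC.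
Qed.

(** Stands in for a metric on the torus: suitable lifts are at distance less than [d] in the maximum
    norm. *)
Definition close_points d p q := exists v, [/\ `|v.1| < d, `|v.2| < d & q = translate p v].

Lemma close_proj d z q : close_points d (proj z) q <->
  exists v, [/\ `|v.1| < d, `|v.2| < d & q = proj (z + v)].
Proof. by split=> -[v [? ? ->]]; exists v; rewrite translate_proj. Qed.

Lemma close_sym d p q : close_points d p q -> close_points d q p.
Proof.
rewrite -(proj_repr p) => /close_proj[v [v1 v2 ->]]; apply/close_proj.
by exists (- v); rewrite addrK !normrN.
Qed.

Lemma close_trans d d' p q t : close_points d p q -> close_points d' q t -> close_points (d + d') p t.
Proof.
rewrite -(proj_repr p) => /close_proj[v [v1 v2 ->]] /close_proj[w [w1 w2 ->]].
apply/close_proj; exists (v + w); rewrite addrA; split=> //;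
  by apply: le_lt_trans (ler_normD _ _) _; exact: ltrD.
Qed.

Lemma close_le d d' p q : d <= d' -> close_points d p q -> close_points d' p q.
Proof. by move=> dd [v [v1 v2 ->]]; exists v; split=> //; exact: lt_le_trans dd. Qed.

(** The preimage in the plane is the union of the lattice translates of a ball, hence open. *)
Lemma nbhs_close d p : 0 < d -> \forall q \near p, close_points d p q.
Proof.
move=> d0; apply: open_nbhs_nbhs; split; last first.
  by exists 0; rewrite normr0 -[in LHS](proj_repr p) -[in RHS](proj_repr p) translate_proj addr0.
rewrite /open /= /quotient_open.
rewrite (_ : _ @^-1` _ = \bigcup_(u : int * int)
  ((fun z : R * R => z - (repr p + latv u)) @^-1` ball (0 : R * R) d)).
  apply: bigcup_open => u _; apply: open_comp; last exact: ball_open.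
  by move=> z _; apply: cvgB; [exact: cvg_id|exact: cvg_cst].
apply/seteqP; split=> z /=.
- rewrite -/(proj z) -(proj_repr p) => /close_proj[v [v1 v2]].
  rewrite proj_repr => /projP[u ->]; exists u => //.
  rewrite /= opprD addrACA subrr addr0 addrAC subrr add0r.
  by split; rewrite /ball /= sub0r normrN.
- move=> [u _] /= []; rewrite /ball /= !sub0r !normrN => h1 h2.
  rewrite -/(proj z) -(proj_repr p); apply/close_proj.
  exists (z - (repr p + latv u)); split=> //.
  by apply/projP; exists u; apply: pair_ext; rewrite /=; ring.
Qed.

(** Lifts of distinct points differ by a non-integer in some coordinate, and a non-integer has a
    positive distance from the integers. *)
Lemma close_separated p q : p <> q -> exists2 d, 0 < d & ~ close_points d p q.
Proof.
rewrite -(proj_repr p) -(proj_repr q); move: (repr p) (repr q) => z z' pq.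
suff [d d0 F] : exists2 d, 0 < d & far d (z' - z).
  exists d => // /close_proj[v [v1 v2 /projP[u e]]].
  have {}e : z' - z = v + latv u by rewrite e; apply: pair_ext; rewrite /=; ring.
  by have := F u.1 u.2; rewrite e /= => -[]; rewrite addrK leNgt ?v1 ?v2.
have gap y : y \isn't a Num.int -> exists2 d, 0 < d & forall m : int, d <= `|y - m%:~R|.
  move=> yint; have := floor_itv y; set f := Num.floor y; rewrite intrD mulr1z => /andP[fy yf].
  have {}fy : f%:~R < y.
    by rewrite lt_neqAle fy andbT; apply: contra yint => /eqP <-; rewrite intr_int.
  exists (Num.min (y - f%:~R) (f%:~R + 1 - y)).
    by rewrite lt_min !subr_gt0 fy yf.
  move=> m; rewrite ge_min; apply/orP; have [mf|fm] := leP m f.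
    move: mf; rewrite -(ler_int R) => mf.
    by left; rewrite ler_normr; apply/orP; left; lra.
  have : f + 1 <= m by lia.
  rewrite -(ler_int R) intrD mulr1z => {}fm.
  by right; rewrite ler_normr; apply/orP; right; lra.
have [i1|/gap[d d0 h]] := boolP ((z' - z).1 \is a Num.int); last first.
  by exists d => // m n; left.
have [i2|/gap[d d0 h]] := boolP ((z' - z).2 \is a Num.int); last first.
  by exists d => // m n; right.
exfalso; apply: pq; apply/esym/projP; move/intrP: i1 => [m hm]; move/intrP: i2 => [n hn].
by exists (m, n); apply: pair_ext; rewrite /= -?hm -?hn /=; ring.
Qed.

End TorusPoints.

(** * Uniform continuity and separation of curves by compactness *)

Section CurvesOnTorus.
Context {R : realType}.
Implicit Types (f g : R -> torus R) (a b d e s t x : R).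

Let I : set R := [set t | 0 <= t <= 1].

Let compact_I : compact I.
Proof.
rewrite (_ : I = `[0, 1]%classic); first exact: segment_compact.
by apply/seteqP; split=> t; rewrite /= in_itv.
Qed.

Lemma curve_near_close f x d : {within I, continuous f} -> 0 < d -> I x ->
  \forall t \near x, I t -> close_points d (f x) (f t).
Proof.
move=> /subspace_continuousP cf d0 Ix; exact: (cf x Ix _ (nbhs_close (f x) d0)).
Qed.

Let near_dist x e : 0 < e -> \forall s \near x, `|s - x| < e.
Proof. by move=> e0; apply/nbhs_ballP; exists e => //= s; rewrite /ball /= distrC. Qed.

Lemma curve_uniform f d : {within I, continuous f} -> 0 < d ->
  \forall e \near 0^'+, forall s t, I s -> I t -> `|t - s| < e -> close_points d (f s) (f t).
Proof.
move=> cf d0; have /compact_near_coveringP /near_covering_withinP cov := compact_I.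
have := cov _ (0^'+ : set_system R)
  (fun e s => forall t, I t -> `|t - s| < e -> close_points d (f s) (f t)) _ _.
move=> h; near=> e => s t Is; move: s Is t; near: e; apply: h => x Ix.
have [e e0 he] : exists2 e, 0 < e &
    forall t, `|t - x| < e -> I t -> close_points (d / 2) (f x) (f t).
  have /nbhs_ballP[e /= e0 he] := curve_near_close cf (divr_gt0 d0 (ltr0n _ 2)) Ix.
  by exists e => // t xt; apply: he; rewrite /ball /= distrC.
exists ([set s | `|s - x| < e / 2], [set e' | e' < e / 2]) => /=.
  by split; [apply: near_dist|apply: nbhs_right_lt]; exact: divr_gt0.
move=> [s e'] /= [sx e'e] Is t It ts.
rewrite [d]splitr; apply: (@close_trans _ _ _ _ (f x)).
  by apply/close_sym/he => //; apply: lt_trans sx _; rewrite ltr_pdivrMr// ltr_pMr// ltr1n.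
apply: he => //; rewrite [e]splitr -(subrKA s) (le_lt_trans (ler_normD _ _))// ltrD//.
exact: lt_trans e'e.
Unshelve. all: by end_near. Qed.

(** The exempt set of pairs of times is open, so the other pairs form a compact set, on which the
    two curves keep a positive distance. With [a = b = 0] no pair is exempt. *)
Lemma curves_apart f g a b : {within I, continuous f} -> {within I, continuous g} ->
  (forall s t, I s -> I t -> ~ (s < a /\ t < b) -> f s <> g t) ->
  \forall d \near 0^'+, forall s t, I s -> I t -> ~ (s < a /\ t < b) ->
    ~ close_points d (f s) (g t).
Proof.
move=> cf cg fg.
have /compact_near_coveringP /near_covering_withinP cov := compact_setX compact_I compact_I.
have := cov _ (0^'+ : set_system R)
  (fun d (z : R * R) => ~ (z.1 < a /\ z.2 < b) -> ~ close_points d (f z.1) (g z.2)) _ _.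
move=> h; near=> d => s t Is It.
suff H : I `*` I `<=` [set z | ~ (z.1 < a /\ z.2 < b) -> ~ close_points d (f z.1) (g z.2)].
  exact: (H (s, t)).
near: d; apply: h => -[x y] [/= Ix Iy].
have [[xa yb]|xy] := pselect (x < a /\ y < b).
  exists ([set z | z.1 < a /\ z.2 < b], setT) => /=; last first.
    by move=> [z d] /= [zab _] _ [].
  split; last exact: filterT.
  exists ([set z | z < a], [set z | z < b]) => /=; last by move=> [].
  by split; exact: lt_nbhsl.
have [d d0 dxy] := close_separated (fg _ _ Ix Iy xy).
have d3 : 0 < d / 3 by exact: divr_gt0.
exists ([set z | (I z.1 -> close_points (d / 3) (f x) (f z.1)) /\
    (I z.2 -> close_points (d / 3) (g y) (g z.2))], [set e | e < d / 3]) => /=.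
  split; last exact: nbhs_right_lt.
  exists ([set z | I z -> close_points (d / 3) (f x) (f z)],
      [set z | I z -> close_points (d / 3) (g y) (g z)]) => /=; last by move=> [].
  by split; exact: curve_near_close.
move=> [[s t] e] /= [[cs ct] ed] [Is It] _ st; apply: dxy.
rewrite (_ : d = d / 3 + d / 3 + d / 3); last by field.
apply: close_trans (close_sym (ct It)); apply: close_trans (cs Is) _.
exact: close_le (ltW ed) st.
Unshelve. all: by end_near. Qed.

End CurvesOnTorus.

(** * Lifting sampled curves to the plane *)

Section DiscreteLifts.
Context {R : realType}.
Implicit Types (d r : R) (z : nat -> R * R) (p : nat -> torus R).

Lemma far_not_close (v v' : R * R) d : ~ close_points d (proj v) (proj v') -> far d (v' - v).
Proof.
move=> nc m n; apply/orP; rewrite 2!leNgt -negb_and; apply/negP => /andP[v1 v2].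
apply: nc; apply/close_proj; exists (v' - v - latv (m, n)); split=> //.
by apply/projP; exists (m, n); apply: pair_ext; rewrite /=; ring.
Qed.

Lemma discrete_lift p d n (v : R * R) : proj v = p 0 ->
  (forall k, (k < n)%N -> close_points d (p k) (p k.+1)) ->
  exists z, [/\ z 0 = v, forall k, (k <= n)%N -> proj (z k) = p k &
    forall k, (k < n)%N -> step d (z k) (z k.+1)].
Proof.
move=> v0; elim: n => [|n IHn] pn.
  by exists (fun=> v); split=> // k; rewrite leqn0 => /eqP ->.
have [k kn|z [z0 zp zs]] := IHn; first by apply: pn; exact: ltnW.
have := pn n (ltnSn n); rewrite -(zp n)// => /close_proj[w [w1 w2 wp]].
exists (fun k => if (k <= n)%N then z k else z n + w); split=> //= k.
  case: (leqP k n) => [kn _|nk kn]; first exact: zp.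
  by rewrite -wp; congr p; apply/eqP; rewrite eqn_leq nk kn.
rewrite ltnS => kn; have [kn'|nk] := ltnP k n; first by rewrite kn; exact: zs.
have -> : k = n by apply/eqP; rewrite eqn_leq kn.
by rewrite leqnn; split; rewrite /= addrAC subrr add0r.
Qed.

Lemma small_int (m : int) : `|m%:~R : R| < 1 -> m = 0.
Proof. by rewrite -intr_norm (_ : 1 = 1%:~R)// ltr_int; lia. Qed.

(* Two lifts of a point differ by a lattice vector, which is zero when it is small. *)
Lemma lift_follows z d r n (b : nat -> R * R) : r < 1 / 4 -> d < 1 / 2 -> 0 <= r ->
  (forall k, (k <= n)%N -> sqnorm (b k) <= r ^+ 2) -> b 0 = 0 ->
  (forall k, (k <= n)%N -> proj (z k) = proj (z 0 + b k)) ->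
  (forall k, (k < n)%N -> step d (z k) (z k.+1)) ->
  forall k, (k <= n)%N -> z k = z 0 + b k.
Proof.
move=> r4 d2 r0 br b0 zb zs; elim=> [|k IHk] kn; first by rewrite b0 addr0.
have [u eu] : exists u, z k.+1 = z 0 + b k.+1 + latv u by exact/projP/zb.
have [s1 s2] := zs _ kn; move: s1 s2; rewrite IHk ?(ltnW kn)// eu.
have [h1 h2] := sqnorm_le_coord r0 (br _ (ltnW kn)).
have [h3 h4] := sqnorm_le_coord r0 (br _ kn).
have eqB (x y t w : R) : x + y + t - (x + w) = t + y - w by ring.
move=> /=; rewrite !eqB => s1 s2.
have small (m : int) (y y' : R) : `|y| <= r -> `|y'| <= r -> `|m%:~R + y - y'| < d -> m = 0.
  rewrite !ler_norml ltr_norml => /andP[? ?] /andP[? ?] /andP[? ?].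
  by apply: small_int; rewrite ltr_norml; apply/andP; split; lra.
have -> : u = 0.
  case: u {eu} s1 s2 => m m' /= s1 s2.
  by rewrite (small m _ _ h3 h1 s1) (small m' _ _ h4 h2 s2).
by rewrite latv0 addr0.
Qed.

End DiscreteLifts.

(** * Legs of tripods, and arcs glued from two legs *)

Section Legs.
Context {R : realType}.

Lemma exits_vector (p : torus R) (r : R) f (a : R * R) (s : R) :
  f 0 = p -> sqnorm a = r ^+ 2 -> f s = translate p a ->
  (forall t, 0 <= t < s -> exists2 b, sqnorm b < r ^+ 2 & f t = translate p b) ->
  exists b : R -> R * R, [/\ b s = a, forall t, 0 <= t <= s -> sqnorm (b t) <= r ^+ 2 &
    forall t, 0 <= t <= s -> f t = translate p (b t)].
Proof.
move=> f0 ar fs H.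
have /choice[b hb] : forall t, exists v, 0 <= t < s ->
    sqnorm v < r ^+ 2 /\ f t = translate p v.
  move=> t; have [ts|ts] := boolP (0 <= t < s); last by exists 0.
  by have [v v1 v2] := H t ts; exists v.
exists (fun t => if t == s then a else b t); split=> [|t ts|t ts]; first by rewrite eqxx.
- case: eqP => [_|/eqP ne]; first by rewrite ar.
  by apply/ltW; have [] // := hb t; move: ts; rewrite !le_eqVlt (negbTE ne)/=.
- case: eqP => [->//|/eqP ne].
  by have [] // := hb t; move: ts; rewrite !le_eqVlt (negbTE ne)/=.
Qed.

(* A partition of [0, 1] into [2 N] steps whose point number [N] is [s]. *)
Definition leg_time (s : R) (N k : nat) : R :=
  if (k <= N)%N then s * (k%:R / N%:R) else s + (1 - s) * ((k - N)%:R / N%:R).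

Section LegTime.
Variables (s : R) (N : nat).
Hypotheses (s_gt0 : 0 < s) (s_le1 : s <= 1) (N_gt0 : (0 < N)%N).

Let N0 : 0 < (N%:R : R). Proof. by rewrite ltr0n. Qed.

Lemma leg_time0 : leg_time s N 0 = 0.
Proof. by rewrite /leg_time leq0n mul0r mulr0. Qed.

Lemma leg_time_exit : leg_time s N N = s.
Proof. by rewrite /leg_time leqnn divff ?mulr1// gt_eqF. Qed.

Lemma leg_time1 : leg_time s N (N + N) = 1.
Proof.
rewrite /leg_time leqNgt -addn1 leq_add2l N_gt0 /= addnK divff ?gt_eqF// mulr1.
by rewrite addrC subrK.
Qed.

Let ratio k : (k <= N)%N -> 0 <= (k%:R / N%:R : R) <= 1.
Proof.
by move=> kN; rewrite divr_ge0//= ler_pdivrMr// mul1r ler_nat.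
Qed.

Lemma leg_time_initial k : (k <= N)%N -> 0 <= leg_time s N k <= s.
Proof.
have s0 := s_gt0; move=> kN; rewrite /leg_time kN.
have /andP[? ?] := ratio kN; apply/andP; split; nra.
Qed.

Lemma leg_time_final k : (N <= k)%N -> s <= leg_time s N k.
Proof.
have s1 := s_le1; rewrite leq_eqVlt => /orP[/eqP <-|Nk]; first by rewrite leg_time_exit.
by rewrite /leg_time leqNgt Nk /= lerDl mulr_ge0 ?subr_ge0.
Qed.

Lemma leg_time_itv k : (k <= N + N)%N -> 0 <= leg_time s N k <= 1.
Proof.
have s0 := s_gt0; have s1 := s_le1.
move=> kN; have [/leg_time_initial/andP[? ?]|Nk] := leqP k N.
  by apply/andP; split; lra.
have := leg_time_final (ltnW Nk) => ?; rewrite (le_trans (ltW s_gt0))//=.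
rewrite /leg_time leqNgt Nk /=.
have /ratio/andP[? ?] : (k - N <= N)%N by lia.
nra.
Qed.

Lemma leg_time_step k : `|leg_time s N k.+1 - leg_time s N k| <= N%:R^-1.
Proof.
have s0 := s_gt0; have s1 := s_le1.
have iN : 0 < N%:R^-1 :> R by rewrite invr_gt0.
rewrite /leg_time; have [kN|Nk|->] := ltngtP k N.
- rewrite -mulrBr -mulrBl -natrB// subSnn mul1r ger0_norm; nra.
- rewrite opprD addrACA subrr add0r -mulrBr -mulrBl -natrB ?leq_sub2r//.
  rewrite subSn 1?ltnW// subSnn mul1r ger0_norm; nra.
- rewrite divff ?gt_eqF//.
  rewrite mulr1 subSnn addrAC subrr add0r mul1r ger0_norm; nra.
Qed.

End LegTime.

(** The lift built step by step has to follow the displacements granted by the exit condition, which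
    need not be chosen continuously: in a small disc, [lift_follows] leaves no other possibility.
    Hence it leaves the disc exactly at [a], at the index [N]. *)
Lemma leg_lift (f : R -> torus R) (W a : R * R) (r d e s : R) N :
  0 <= r < 1 / 4 -> d < 1 / 2 -> 0 < s -> s <= 1 -> (0 < N)%N -> N%:R^-1 < e ->
  f 0 = proj W -> sqnorm a = r ^+ 2 -> f s = translate (proj W) a ->
  (forall t, 0 <= t < s -> exists2 b, sqnorm b < r ^+ 2 & f t = translate (proj W) b) ->
  (forall t t', 0 <= t <= 1 -> 0 <= t' <= 1 -> `|t' - t| < e -> close_points d (f t) (f t')) ->
  exists z : nat -> R * R,
    [/\ z 0 = W, z N - W = a,
        forall k, (k <= N + N)%N -> proj (z k) = f (leg_time s N k),
        forall k, (k < N + N)%N -> step d (z k) (z k.+1) &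
        forall k, (k <= N)%N -> sqnorm (z k - W) <= r ^+ 2].
Proof.
move=> /andP[r0 r4] d2 s0 s1 N0 Ne f0 ar fs H U.
have [b [bs br fb]] := exits_vector f0 ar fs H.
have itv k : (k <= N + N)%N -> 0 <= leg_time s N k <= 1 by exact: leg_time_itv.
have [|k kN|z [z0 zp zs]] := @discrete_lift R (fun k => f (leg_time s N k)) d (N + N) W.
- by rewrite leg_time0 f0.
- by apply: U; [exact/itv/ltnW|exact: itv|exact: le_lt_trans (leg_time_step _ _ _ _) Ne].
(* At index 0 the displacement is set to zero, which starts the induction in [lift_follows]. *)
pose b' k : R * R := if k == 0%N then 0 else b (leg_time s N k).
have follows k : (k <= N)%N -> z k = W + b' k.
  rewrite -z0; apply: (@lift_follows R z d r N b') => // [j jN|j jN|j jN].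
  - rewrite /b'; case: eqP => _; first by rewrite /sqnorm expr0n /= addr0 sqr_ge0.
    exact/br/leg_time_initial.
  - rewrite /b'; case: eqP => [->|_]; first by rewrite addr0.
    rewrite zp ?(leq_trans jN) ?leq_addr// fb ?translate_proj ?z0//.
    exact: leg_time_initial.
  - by apply: zs; rewrite (leq_trans jN)// leq_addr.
exists z; split=> // [|k kN].
  by rewrite follows// /b' gtn_eqF// leg_time_exit// bs addrC addKr.
rewrite follows// addrC addKr /b'; case: eqP => _.
  by rewrite /sqnorm expr0n /= addr0 sqr_ge0.
exact/br/leg_time_initial.
Qed.

(** The exit is halfway, at index [N] of [2 N], so a leg followed by a reversed leg has its exit at
    [N] and its entry at [3 N] of [4 N], whatever the actual times are. *)
Record lifted_leg (W C : R * R) (r d : R) (N : nat) (z : nat -> R * R) (m : int * int)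
  : Prop := LiftedLeg {
  leg_start : z 0 = W;
  leg_end : z (N + N) = C + latv m;
  leg_near : forall k, (k <= N)%N -> sqnorm (z k - W) <= r ^+ 2;
  leg_exit : sqnorm (z N - W) = r ^+ 2;
  leg_step : forall k, (k < N + N)%N -> step d (z k) (z k.+1) }.

(** First the leg [z], then [z'] backwards. The ends fit together for [u = m - m'], which becomes
    the lattice vector of the arc. *)
Definition glue (N : nat) (z z' : nat -> R * R) (u : int * int) (k : nat) : R * R :=
  if (k <= N + N)%N then z k else z' (N + N + N + N - k)%N + latv u.

Section Glue.
Variables (d : R) (N : nat).
Hypothesis N_gt0 : (0 < N)%N.

Lemma glue_second (W W' C : R * R) (r r' : R) z z' m m' k :
  lifted_leg W C r d N z m -> lifted_leg W' C r' d N z' m' ->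
  (N + N <= k)%N -> glue N z z' (m - m') k = z' (N + N + N + N - k)%N + latv (m - m').
Proof.
move=> Z Z'; rewrite /glue leq_eqVlt => /orP[/eqP <-|]; last by rewrite ltnNge => /negbTE ->.
rewrite leqnn (leg_end Z) (_ : (_ - _ = N + N)%N); last lia.
by rewrite (leg_end Z') latvD latvN; apply: pair_ext; rewrite /=; ring.
Qed.

Lemma glue_arc (W W' C : R * R) (r r' : R) z z' m m' :
  lifted_leg W C r d N z m -> lifted_leg W' C r' d N z' m' ->
  lifted_arc W W' r r' d N (N + N + N) (N + N + N + N) (glue N z z' (m - m')) (m - m').
Proof.
move=> Z Z'; have second k := glue_second (k := k) Z Z'.
have eqB v w u : v + latv u - (w + latv u) = v - w :> R * R.
  by apply: pair_ext; rewrite /=; ring.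
split.
- by rewrite /glue (leg_start Z).
- by rewrite second ?subnn ?(leg_start Z')//; lia.
- move=> k kN; rewrite /glue (leq_trans kN) ?leq_addr//; exact: leg_near Z _ kN.
- rewrite /glue leq_addr; exact: leg_exit Z.
- move=> k /andP[k1 k2]; rewrite second; last lia.
  by rewrite eqB; apply: leg_near Z' _ _; lia.
- rewrite second; last lia.
  by rewrite eqB addKn; exact: leg_exit Z'.
- move=> k kn; have [k2|k2] := ltnP k (N + N).
    by rewrite /glue k2 ltnW//; exact: leg_step Z _ k2.
  rewrite !second ?(leq_trans k2)//.
  have [] := @leg_step _ _ _ _ _ _ _ Z' (N + N + N + N - k.+1)%N _; first lia.
  rewrite (_ : (_ - k.+1).+1 = (N + N + N + N - k)%N); last lia.
  have eqD (x y t : R) : x + t - (y + t) = x - y by ring.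
  by move=> h1 h2; split; rewrite /= eqD distrC.
Qed.

Lemma glue_apart (z1 z2 z1' z2' : nat -> R * R) u1 u2 :
  (forall k l, (k <= N + N)%N -> (l <= N + N)%N -> ~~ ((k < N) && (l < N))%N ->
     far (d *+ 2) (z1 k - z2 l) /\ far (d *+ 2) (z1' k - z2' l)) ->
  (forall k l, (k <= N + N)%N -> (l <= N + N)%N ->
     far (d *+ 2) (z1 k - z2' l) /\ far (d *+ 2) (z1' k - z2 l)) ->
  apart d N (N + N + N) (N + N + N + N) (glue N z1 z1' u1) (glue N z2 z2' u2).
Proof.
move=> same other k l kn ln kl kl'; rewrite /glue.
have [k2|k2] := leqP k (N + N); have [l2|l2] := leqP l (N + N).
- by have [] := same k l k2 l2 kl.
- have [|+ _] := other k (N + N + N + N - l)%N k2 _; first lia.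
  by move=> /(farD (- u2)); rewrite latvN opprD addrA.
- have [|_ +] := other (N + N + N + N - k)%N l _ l2; first lia.
  by move=> /(farD u1); rewrite addrAC.
- have [|||_ +] := same (N + N + N + N - k)%N (N + N + N + N - l)%N; [lia|lia|..].
    by apply: contra kl' => /andP[? ?]; apply/andP; split; lia.
  by move=> /(farD (u1 - u2)); rewrite latvD latvN addrACA -opprD.
Qed.

End Glue.

(** Gluing the legs with the same [C x] turns two tripods into the three arcs of a theta graph. *)
Lemma theta_cross_sum (W W' : R * R) (C : 'I_3 -> R * R) (r r' d : R) N
    (z z' : 'I_3 -> nat -> R * R) (m m' : 'I_3 -> int * int) :
  0 <= r < 1 / 2 -> 0 <= r' < 1 / 2 -> (0 < N)%N ->
  (forall x, lifted_leg W (C x) r d N (z x) (m x)) ->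
  (forall x, lifted_leg W' (C x) r' d N (z' x) (m' x)) ->
  clockwise_points (z 0 N - W) (z 1 N - W) (z 2 N - W) ->
  clockwise_points (z' 0 N - W') (z' 1 N - W') (z' 2 N - W') ->
  (forall x y k l, x != y -> (k <= N + N)%N -> (l <= N + N)%N ->
     ~~ ((k < N) && (l < N))%N ->
     far (d *+ 2) (z x k - z y l) /\ far (d *+ 2) (z' x k - z' y l)) ->
  (forall x y k l, x != y -> (k <= N + N)%N -> (l <= N + N)%N ->
     far (d *+ 2) (z x k - z' y l) /\ far (d *+ 2) (z' x k - z y l)) ->
  cross_sum (m 0 - m' 0) (m 1 - m' 1) (m 2 - m' 2) = -1.
Proof.
move=> r2 r2' N0 Z Z' cw cw' same other.
pose g x := glue N (z x) (z' x) (m x - m' x).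
have ap x y : x != y -> apart d N (N + N + N) (N + N + N + N) (g x) (g y).
  by move=> xy; apply: glue_apart => // k l *; [exact: same|exact: other].
have gN x : g x N - W = z x N - W by rewrite /g /glue leq_addr.
have gN' x : g x (N + N + N)%N - (W' + latv (m x - m' x)) = z' x N - W'.
  rewrite /g (glue_second N0 (Z x) (Z' x)) ?leq_addr// addKn.
  by apply: pair_ext; rewrite /=; ring.
apply: (@cross_sum_three_arcs R W W' r r' d N (N + N + N) (N + N + N + N) (g 0) (g 1) (g 2)).
- by [].
- by [].
- by apply/andP; split; lia.
- exact: glue_arc.
- exact: glue_arc.
- exact: glue_arc.
- exact: ap.
- exact: ap.
- exact: ap.
- by rewrite !gN.
- by rewrite !gN'.
Qed.

End Legs.

(** * Four disjoint tripods with the same rotation do not exist *)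

Section NoCoherentTripods.
Context {R : realType}.

Lemma I3_ind (P : 'I_3 -> Prop) : P 0 -> P 1 -> P 2 -> forall x, P x.
Proof.
by move=> P0 P1 P2 [[|[|[|//]]] x3]; [move: P0|move: P1|move: P2]; congr P; exact: val_inj.
Qed.

Let I : set R := [set t | 0 <= t <= 1].

Variables (w : 'I_4 -> torus R) (c : 'I_3 -> torus R) (f : 'I_4 -> 'I_3 -> R -> torus R).
Hypothesis f_cont : forall i x, {within I, continuous (f i x)}.
Hypothesis f_start : forall i x, f i x 0 = w i.
Hypothesis f_end : forall i x, f i x 1 = c x.
Hypothesis c_neq : forall i x, c x <> w i.
Hypothesis f_disjoint : forall i j x y s t, x != y -> I s -> I t ->
  f i x s = f j y t -> [/\ i = j, s = 0 & t = 0].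
Hypothesis f_clockwise : forall i, clockwise_arcs (w i) (f i 0) (f i 1) (f i 2).

Let exit_of i (r : R) (a : R * R) (x : 'I_3) (s : R) :=
  [/\ 0 < s, s <= 1, sqnorm a = r ^+ 2, f i x s = translate (w i) a &
    forall t, 0 <= t < s -> exists2 b, sqnorm b < r ^+ 2 & f i x t = translate (w i) b].

(** The radius is taken below the separation of [w i] from every [c x]. A leg is then outside the
    disc at time 1, so its exit time is at most 1. *)
Lemma tripod_exits i : exists (r : R) (a : 'I_3 -> R * R) (s : 'I_3 -> R),
  [/\ 0 <= r < 1 / 4, clockwise_points (a 0) (a 1) (a 2) & forall x, exit_of i r (a x) x (s x)].
Proof.
have /choice[D hD] : forall x, exists d, 0 < d /\ ~ close_points d (w i) (c x).
  by move=> x; have [d d0 hd] := close_separated (nesym (@c_neq i x)); exists d.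
have exits1 r (a : R * R) x : 0 < r -> r < D x -> exits_at (w i) r (f i x) a ->
    exists s, exit_of i r a x s.
  move=> r0 rD [ar [s [s0 fs hs]]]; exists s; split=> //.
  rewrite leNgt; apply/negP => s1; have [_] := hD x; apply.
  have [|b br] := hs 1; first by rewrite ler01.
  rewrite f_end => cb; exists b.
  have [b1 b2] : `|b.1| < D x /\ `|b.2| < D x.
    split; apply: le_lt_trans rD; have [] // := sqnorm_le_coord (ltW r0) (ltW br).
  by split.
near (0 : R)^'+ => r.
have r0 : 0 < r by [].
have r4 : r < 1 / 4 by near: r; apply: nbhs_right_lt; rewrite divr_gt0.
have rD x : r < D x.
  move: x; near: r; apply: filter_forall => x; apply: nbhs_right_lt.
  by have [] := hD x.
have [a [b [e [/exits1 ha /exits1 hb /exits1 he cw]]]] : exists a b c : R * R,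
    [/\ exits_at (w i) r (f i 0) a, exits_at (w i) r (f i 1) b,
        exits_at (w i) r (f i 2) c & clockwise_points a b c].
  by near: r; exact: f_clockwise.
have [[s1 h1] [s2 h2] [s3 h3]] := And3 (ha r0 (rD _)) (hb r0 (rD _)) (he r0 (rD _)).
exists r, (fun x : 'I_3 => nth 0 [:: a; b; e] x), (fun x : 'I_3 => nth 0 [:: s1; s2; s3] x).
split=> //; first by rewrite ltW.
exact: I3_ind.
Unshelve. all: by end_near. Qed.

Lemma no_coherent_tripods : False.
Proof.
have /choice[r /choice[a /choice[s ras]]] := tripod_exits.
have r4 i : 0 <= r i < 1 / 4 by have [] := ras i.
have cw i : clockwise_points (a i 0) (a i 1) (a i 2) by have [] := ras i.
have ex i x : exit_of i (r i) (a i x) x (s i x) by have [_ _] := ras i.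
(* Legs of the same tripod are compared only once one of them has left the disc; legs of different
   tripods are compared at all times. *)
pose cut i j x := if i == j then s i x else 0.
(* [e] is a separation of all legs to different ends, [g] a modulus of continuity for [e / 2], and
   [1 / N] is less than [g]. With steps below [d = e / 2], the distance [2 * d] demanded by [apart]
   is exactly [e]. *)
near (0 : R)^'+ => e.
have e0 : 0 < e by [].
have e1 : e < 1 by near: e; exact: nbhs_right_lt.
have ap i j x y : x != y -> forall t t', I t -> I t' ->
    ~ (t < cut i j x /\ t' < cut i j y) -> ~ close_points e (f i x t) (f j y t').
  move: i j x y; near: e.
  apply: filter_forall => i; apply: filter_forall => j.
  apply: filter_forall => x; apply: filter_forall => y.
  have [->|xy] := eqVneq x y; first by near=> e.
  have := @curves_apart R (f i x) (f j y) (cut i j x) (cut i j y) (@f_cont i x) (@f_cont j y) _.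
  move=> h; near=> e => _; near: e; apply: h => t t' It It' tt' ff.
  have [ij t0 t'0] := f_disjoint xy It It' ff.
  apply: tt'; rewrite /cut ij eqxx t0 t'0; have [[? _ _ _ _] [? _ _ _ _]] := (ex j x, ex j y).
  by [].
near (0 : R)^'+ => g.
have un i x : forall t t', I t -> I t' -> `|t' - t| < g ->
    close_points (e / 2) (f i x t) (f i x t').
  move: i x; near: g; apply: filter_forall => i; apply: filter_forall => x.
  by apply: curve_uniform => //; exact: divr_gt0.
have [N N0 Ng] : exists2 N : nat, (0 < N)%N & N%:R^-1 < g.
  have g0 : 0 < g by [].
  exists (Num.truncn g^-1).+1 => //.
  by rewrite invf_plt ?posrE// truncnS_gt.
have lift i x : exists zm : (nat -> R * R) * (int * int),
    [/\ lifted_leg (repr (w i)) (repr (c x)) (r i) (e / 2) N zm.1 zm.2,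
        zm.1 N - repr (w i) = a i x &
        forall k, (k <= N + N)%N -> proj (zm.1 k) = f i x (leg_time (s i x) N k)].
  have [s0 s1 ar fs hs] := ex i x.
  have f0 : f i x 0 = proj (repr (w i)) by rewrite f_start proj_repr.
  have e2 : e / 2 < 1 / 2 by rewrite ltr_pM2r ?invr_gt0.
  rewrite -[X in translate X _]proj_repr in fs.
  have hs' t : 0 <= t < s i x ->
      exists2 b, sqnorm b < r i ^+ 2 & f i x t = translate (proj (repr (w i))) b.
    by rewrite proj_repr; exact: hs.
  have [z [z0 za zp zs zr]] := leg_lift (r4 i) e2 s0 s1 N0 Ng f0 ar fs hs' (@un i x).
  have [m zm] : exists m, z (N + N)%N = repr (c x) + latv m.
    by apply/projP; rewrite zp// leg_time1// f_end proj_repr.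
  by exists (z, m); split=> //; split=> //; rewrite /= za.
have /choice[zm hzm] : forall i, exists zm : 'I_3 -> (nat -> R * R) * (int * int), forall x,
    [/\ lifted_leg (repr (w i)) (repr (c x)) (r i) (e / 2) N (zm x).1 (zm x).2,
        (zm x).1 N - repr (w i) = a i x &
        forall k, (k <= N + N)%N -> proj ((zm x).1 k) = f i x (leg_time (s i x) N k)].
  by move=> i; have /choice[z hz] := lift i; exists z.
have itv i x k : (k <= N + N)%N -> I (leg_time (s i x) N k).
  by move=> kN; have [? ? _ _ _] := ex i x; exact: leg_time_itv.
have apart_legs i j x y k l : x != y -> (k <= N + N)%N -> (l <= N + N)%N ->
    (i == j -> ~~ ((k < N) && (l < N))%N) ->
    far (e / 2 *+ 2) ((zm i x).1 k - (zm j y).1 l).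
  move=> xy kN lN ijkl; rewrite -mulr_natr divfK//; apply: far_not_close.
  have [_ _ /(_ _ kN) ->] := hzm i x; have [_ _ /(_ _ lN) ->] := hzm j y.
  move=> /close_sym; apply: ap => //; [exact: itv|exact: itv|].
  have [[s0 s1 _ _ _] [s0' s1' _ _ _]] := (ex i x, ex j y).
  rewrite /cut; have [ij|_] := eqVneq i j; last first.
    by have /andP[+ _] := itv i x k kN => t0 [/(le_lt_trans t0)]; rewrite ltxx.
  move: (ijkl (introT eqP ij)); rewrite negb_and -!leqNgt => /orP[Nk|Nl] [h h'].
    by have := le_lt_trans (leg_time_final s1 N0 Nk) h; rewrite ltxx.
  by have := le_lt_trans (leg_time_final s1' N0 Nl) h'; rewrite ij ltxx.
apply: (@no_unit_quadruple (fun i x => (zm i x).2)) => i j ij.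
have r2 k : 0 <= r k < 1 / 2 by have /andP[? ?] := r4 k; apply/andP; split; lra.
have leg k x : lifted_leg (repr (w k)) (repr (c x)) (r k) (e / 2) N (zm k x).1 (zm k x).2.
  by have [] := hzm k x.
have zN k x : (zm k x).1 N - repr (w k) = a k x by have [] := hzm k x.
apply: (@theta_cross_sum R _ _ (fun x => repr (c x)) _ _ (e / 2) N (fun x => (zm i x).1)
  (fun x => (zm j x).1) (fun x => (zm i x).2) (fun x => (zm j x).2) (r2 i) (r2 j) N0
  (leg i) (leg j)).
- by rewrite !zN.
- by rewrite !zN.
- by move=> x y k l xy kN lN kl; split; apply: apart_legs.
- by move=> x y k l xy kN lN; split; apply: apart_legs => //;
    [rewrite (negbTE ij)|rewrite eq_sym (negbTE ij)].
Unshelve. all: by end_near. Qed.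

End NoCoherentTripods.

(** * A drawing with straight edges *)

Definition det2 (T : pzRingType) (v w : T * T) : T := v.1 * w.2 - v.2 * w.1.

Section Lines.
Context {R : realType}.
Implicit Types (p q v w u : R * R) (r s t : R).

Definition vmul t v : R * R := (t * v.1, t * v.2).

Definition line p v t : torus R := proj (p + vmul t v).

Lemma line0 p v : line p v 0 = proj p.
Proof. by rewrite /line; congr proj; apply: pair_ext; rewrite /= mul0r addr0. Qed.

Lemma line1 p v : line p v 1 = proj (p + v).
Proof. by rewrite /line; congr proj; apply: pair_ext; rewrite /= mul1r. Qed.

Lemma line_reverse p v t : line (p + v) (- v) t = line p v (1 - t).
Proof. by congr proj; apply: pair_ext; rewrite /=; ring. Qed.

Lemma forward_line p v s : forward (line p v) s = line (p + vmul s v) v.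
Proof. by apply/funext => t; congr proj; apply: pair_ext; rewrite /=; ring. Qed.

Lemma backward_line p v s : backward (line p v) s = line (p + vmul s v) (- v).
Proof. by apply/funext => t; congr proj; apply: pair_ext; rewrite /=; ring. Qed.

Lemma line_continuous p v : continuous (line p v).
Proof.
move=> t; apply: (@continuous_comp _ _ _ (fun t => p + vmul t v) proj); last exact: pi_continuous.
apply: cvgD; first exact: cvg_cst.
have cv (y : R) : (fun t => t * y) @ t --> t * y by apply: cvgM; [exact: cvg_id|exact: cvg_cst].
exact: (cvg_pair (cv v.1) (cv v.2)).
Qed.

Lemma exits_line p v r : v <> 0 -> 0 < r ->
  exists2 k, 0 < k & exits_at (proj p) r (line p v) (vmul k v).
Proof.
move=> v0 r0.
have sq_gt0 : 0 < sqnorm v.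
  rewrite lt_neqAle addr_ge0 ?sqr_ge0// andbT eq_sym paddr_eq0 ?sqr_ge0// !sqrf_eq0.
  by apply/negP => /andP[/eqP v1 /eqP v2]; apply: v0; exact: pair_ext.
have sq t : sqnorm (vmul t v) = t ^+ 2 * sqnorm v by rewrite /sqnorm /=; ring.
have k0 : 0 < r / Num.sqrt (sqnorm v) by rewrite divr_gt0// sqrtr_gt0.
exists (r / Num.sqrt (sqnorm v)) => //; split.
  by rewrite sq expr_div_n sqr_sqrtr ?(ltW sq_gt0)// divfK// gt_eqF.
exists (r / Num.sqrt (sqnorm v)); split=> //; first by rewrite translate_proj.
move=> t /andP[t0 tk]; exists (vmul t v); last by rewrite translate_proj.
rewrite sq -ltr_pdivlMr// -[X in _ < _ / X](sqr_sqrtr (ltW sq_gt0)) -expr_div_n.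
by rewrite ltr_pXn2r// nnegrE ltW.
Qed.

(** The orientation of the triangle of exit points is a combination of the three determinants with
    positive coefficients. The last one may vanish, as it does at a crossing, where [w = - u]. *)
Lemma clockwise_lines p u v w : u <> 0 -> v <> 0 -> w <> 0 ->
  det2 u v < 0 -> det2 v w < 0 -> det2 w u <= 0 ->
  clockwise_arcs (proj p) (line p u) (line p v) (line p w).
Proof.
move=> u0 v0 w0 uv vw wu; near=> r.
have r0 : 0 < r by [].
have [a a0 ha] := exits_line p u0 r0; have [b b0 hb] := exits_line p v0 r0.
have [c c0 hc] := exits_line p w0 r0.
exists (vmul a u), (vmul b v), (vmul c w); split => //.
rewrite /clockwise_points (_ : _ - _ = a * b * det2 u v + b * c * det2 v w + c * a * det2 w u).
  have h1 : a * b * det2 u v < 0 by rewrite pmulr_rlt0 ?mulr_gt0.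
  have h2 : b * c * det2 v w < 0 by rewrite pmulr_rlt0 ?mulr_gt0.
  have h3 : c * a * det2 w u <= 0 by rewrite pmulr_rle0 ?mulr_gt0.
  lra.
by rewrite /det2 /=; ring.
Unshelve. all: by end_near. Qed.

Lemma crossings_lines p v q w : det2 v w != 0 ->
  crossings (line p v) (line q w) = inner_points (line p v) `&` inner_points (line q w).
Proof.
move=> D0.
have v0 : v <> 0 by move=> v0; rewrite v0 /det2 /= !mul0r subrr eqxx in D0.
have w0 : w <> 0 by move=> w0; rewrite w0 /det2 /= !mulr0 subrr eqxx in D0.
have oppN0 (z : R * R) : z <> 0 -> - z <> 0 by move=> z0 h; apply/z0/eqP; rewrite -oppr_eq0; apply/eqP.
apply/seteqP; split=> x.
  by move=> [s [t [s01 t01 fs gt _]]]; split; [exists s|exists t].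
move=> [[s s01 fs] [t t01 gt]]; exists s, t; split=> //.
rewrite !forward_line !backward_line -fs.
have cw a b (y := p + vmul s v) (y' := q + vmul t w) : a <> 0 -> b <> 0 -> det2 a b < 0 ->
    clockwise_arcs (line p v s) (line y a) (line y' b) (line y (- a)).
  move=> a0 b0 ab.
  (* The lines reach their common point of the torus in lifts that may differ by a lattice
     vector. *)
  have -> : line y' b = line y b.
    have /projP[u e] : proj y' = proj y by rewrite -/(line q w t) gt -fs.
    by apply/funext => k; apply/projP; exists u; rewrite e addrAC.
  apply: clockwise_lines => //; first exact: oppN0.
    by rewrite (_ : det2 _ _ = det2 a b)// /det2 /=; ring.
  by rewrite (_ : det2 _ _ = 0)// /det2 /=; ring.
have detNN : det2 (- v) (- w) = det2 v w by rewrite /det2 /=; ring.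
have detN : det2 v (- w) = - det2 v w by rewrite /det2 /=; ring.
have detN' : det2 (- v) w = - det2 v w by rewrite /det2 /=; ring.
have cw' b : b <> 0 -> det2 (- v) b < 0 -> 
    clockwise_arcs (line p v s) (line (p + vmul s v) (- v)) (line (q + vmul t w) b)
      (line (p + vmul s v) v).
  by move=> b0 D; have := cw (- v) b (oppN0 _ v0) b0 D; rewrite opprK.
have [D|D] : det2 v w < 0 \/ 0 < det2 v w by move: D0; case: ltgtP => //; [left|right].
- by left; split; [exact: cw|apply: cw' => //; [exact: oppN0|rewrite detNN]].
- by right; split; [apply: cw => //; [exact: oppN0|rewrite detN oppr_lt0]
    |apply: cw' => //; rewrite detN' oppr_lt0].
Qed.

End Lines.

(** * Intersections of segments with integer coordinates *)

Local Notation Z := BinNums.Z.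

Section IntegerSegments.
Context {R : realType}.
Implicit Types (P Q d e X m : Z * Z) (n k : Z) (s t : R).

Definition zr n : R := (int_of_Z n)%:~R.

Lemma zrD n k : zr (n + k) = zr n + zr k. Proof. by rewrite /zr rmorphD intrD. Qed.
Lemma zrN n : zr (- n) = - zr n. Proof. by rewrite /zr rmorphN mulrNz. Qed.
Lemma zrB n k : zr (n - k) = zr n - zr k. Proof. by rewrite zrD zrN. Qed.
Lemma zrM n k : zr (n * k) = zr n * zr k. Proof. by rewrite /zr rmorphM intrM. Qed.
Lemma zr_nat (j : nat) : zr j%:R = j%:R. Proof. by rewrite /zr !rmorph_nat. Qed.

Lemma zr0 : zr 0 = 0. Proof. by []. Qed.

Lemma zr_le n k : (zr n <= zr k) = (n <= k).
Proof. by rewrite ler_int; apply/idP/idP; lia. Qed.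

Lemma zr_lt n k : (zr n < zr k) = (n < k).
Proof. by rewrite !ltNge zr_le. Qed.

Lemma zr_eq n k : (zr n == zr k) = (n == k).
Proof. by rewrite !eq_le !zr_le. Qed.

(* The unit of the integer coordinates is 1 / 11. *)
Definition zpt P : R * R := (zr P.1 / 11, zr P.2 / 11).

Definition seg P d : R -> torus R := line (zpt P) (zpt d).

(** The vector from [P] to the translate of [Q] by the lattice vector [m], in units of 1 / 11. *)
Definition shift P Q m : Z * Z := (Q.1 - P.1 + 11 * m.1, Q.2 - P.2 + 11 * m.2).

Lemma shift_inj P Q : injective (shift P Q).
Proof. by move=> m m' /pair_equal_spec[h1 h2]; apply: pair_ext; lia. Qed.

Lemma zlatP (z z' : R * R) : proj z = proj z' <-> exists m : Z * Z, z = z' + (zr m.1, zr m.2).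
Proof.
rewrite projP; split=> [[[a b] ->]|[m ->]]; last by exists (int_of_Z m.1, int_of_Z m.2).
by exists (Z_of_int a, Z_of_int b); rewrite /zr !Z_of_intK.
Qed.

Lemma seg_eqP P d Q e s t : seg P d s = seg Q e t <-> exists m,
  s * zr d.1 - t * zr e.1 = zr (shift P Q m).1 /\
  s * zr d.2 - t * zr e.2 = zr (shift P Q m).2.
Proof.
have key (x y a b m : R) : x / 11 + s * (a / 11) = y / 11 + t * (b / 11) + m <->
    s * a - t * b = y - x + 11 * m.
  by split=> h; lra.
rewrite zlatP; split=> -[m h]; exists m.
  rewrite /shift !zrD !zrN !zrM !zr_nat.
  by move/pair_equal_spec: h => -[h1 h2]; split; apply/key.
move: h; rewrite /shift !zrD !zrN !zrM !zr_nat => -[h1 h2].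
by apply: pair_ext => /=; apply/key.
Qed.

(* A lattice translation that makes two edges of the drawing meet is in [box]. *)
Definition range9 : seq Z := [:: -4; -3; -2; -1; 0; 1; 2; 3; 4].
Definition box : seq (Z * Z) := [seq (a, b) | a <- range9, b <- range9].

Lemma mem_range9 n : (-4 <= n <= 4) = (n \in range9).
Proof. by rewrite !inE; apply/idP/idP; lia. Qed.

Lemma mem_box m : -4 <= m.1 <= 4 -> -4 <= m.2 <= 4 -> m \in box.
Proof. by rewrite !mem_range9; case: m => a b /= ha hb; apply/allpairsP; exists (a, b). Qed.

Definition tame P := [&& 0 <= P.1, P.1 <= 10, 0 <= P.2 & P.2 <= 10].
Definition short d := [&& -17 <= d.1, d.1 <= 17, -17 <= d.2 & d.2 <= 17].

(** In each coordinate the two edges contribute at most 17 each and the difference of their starting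
    points at most 10, and [17 + 17 + 10 = 4 * 11]. *)
Lemma shift_box P Q d e s t m : tame P -> tame Q -> short d -> short e ->
  0 <= s <= 1 -> 0 <= t <= 1 ->
  s * zr d.1 - t * zr e.1 = zr (shift P Q m).1 ->
  s * zr d.2 - t * zr e.2 = zr (shift P Q m).2 -> m \in box.
Proof.
move=> /and4P[P1 P2 P3 P4] /and4P[Q1 Q2 Q3 Q4] /and4P[d1 d2 d3 d4] /and4P[e1 e2 e3 e4].
move=> /andP[s0 s1] /andP[t0 t1].
have bound (x y a b c : Z) : 0 <= x -> x <= 10 -> 0 <= y -> y <= 10 -> -17 <= a -> a <= 17 ->
    -17 <= b -> b <= 17 -> s * zr a - t * zr b = zr (y - x + 11 * c) -> -4 <= c <= 4.
  move=> x0 x1 y0 y1 a0 a1 b0 b1 h.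
  have zr17 : zr 17 = 17 := zr_nat 17.
  have : -34 <= zr (y - x + 11 * c) <= 34.
    have ha : -17 <= s * zr a <= 17.
      rewrite -zr_le zrN zr17 in a0; rewrite -zr_le zr17 in a1.
      by apply/andP; split; nra.
    have hb : -17 <= t * zr b <= 17.
      rewrite -zr_le zrN zr17 in b0; rewrite -zr_le zr17 in b1.
      by apply/andP; split; nra.
    by move: ha hb; rewrite -h => /andP[? ?] /andP[? ?]; apply/andP; split; lra.
  have -> : 34 = zr 34 :> R := esym (zr_nat 34).
  rewrite -zrN !zr_le; lia.
by move=> h1 h2; apply: mem_box; [exact: bound h1|exact: bound h2].
Qed.

(** Cramer's rule without division: the parameters [S / D] and [T / D] of the common point lie
    strictly between 0 and 1. *)
Definition hit d e X : bool :=
  let D := det2 d e in let S := det2 X e in let T := det2 X d in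
  if 0 < D then [&& 0 < S, S < D, 0 < T & T < D] else [&& D < S, S < 0, D < T & T < 0].

Definition meets P d Q e : seq (Z * Z) := [seq m <- box | hit d e (shift P Q m)].

Definition param d e X : R := zr (det2 X e) / zr (det2 d e).

Lemma zr_det d e : zr (det2 d e) = det2 (zr d.1, zr d.2) (zr e.1, zr e.2).
Proof. by rewrite /det2 zrB !zrM. Qed.

Lemma cramer d e X s t : det2 d e != 0 ->
  (s * zr d.1 - t * zr e.1 = zr X.1 /\ s * zr d.2 - t * zr e.2 = zr X.2) <->
  (s = param d e X /\ t = zr (det2 X d) / zr (det2 d e)).
Proof.
rewrite -zr_eq => D0.
have D1 : zr (det2 d e) != 0 by rewrite (_ : 0 = zr 0).
rewrite /param; move: D1; rewrite !zr_det /det2 /= => D1; split=> -[h1 h2].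
  by rewrite -h1 -h2; split; apply: (mulIf D1); rewrite divfK//; ring.
by rewrite h1 h2; split; field.
Qed.

Lemma hitP d e X : det2 d e != 0 ->
  hit d e X = (0 < param d e X < 1) && (0 < zr (det2 X d) / zr (det2 d e) < 1).
Proof.
move=> D0; rewrite /hit /param.
case: ltgtP D0 => // D _.
- have D1 : 0 < zr (det2 d e) by rewrite -zr0 zr_lt.
  rewrite !ltr_pdivlMr// !ltr_pdivrMr// !mul0r !mul1r -zr0 !zr_lt; lia.
- have D1 : zr (det2 d e) < 0 by rewrite -zr0 zr_lt.
  rewrite !ltr_ndivlMr// !ltr_ndivrMr// !mul0r !mul1r -zr0 !zr_lt; lia.
Qed.

Lemma in01 t : 0 < t < 1 -> 0 <= t <= 1.
Proof. by move=> /andP[? ?]; rewrite !ltW. Qed.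

Section Pair.
Variables P d Q e : Z * Z.
Hypotheses (tP : tame P) (tQ : tame Q) (sd : short d) (se : short e).
Hypothesis D0 : det2 d e != 0.

Lemma seg_meetP s t : 0 <= s <= 1 -> 0 <= t <= 1 -> seg P d s = seg Q e t ->
  exists2 m, m \in box & s = param d e (shift P Q m) /\
    t = zr (det2 (shift P Q m) d) / zr (det2 d e).
Proof.
move=> s01 t01 /seg_eqP[m [h1 h2]]; exists m; first exact: shift_box h1 h2.
by apply/(cramer _ _ _ D0); split.
Qed.

Lemma seg_meet_finite : finite_set (curve_points (seg P d) `&` curve_points (seg Q e)).
Proof.
apply: (@sub_finite_set _ _ [set seg P d (param d e (shift P Q m)) | m in [set` box]]).
  move=> x [[s s01 fs] [t t01 gt]].
  have [|m mb [sE _]] := seg_meetP s01 t01; first by rewrite fs gt.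
  by exists m => //; rewrite -sE.
exact/finite_image/finite_seq.
Qed.

Lemma seg_inner_meets : inner_points (seg P d) `&` inner_points (seg Q e) =
  [set seg P d (param d e (shift P Q m)) | m in [set` meets P d Q e]].
Proof.
apply/seteqP; split=> x.
  move=> [[s s01 fs] [t t01 gt]].
  have [|m mb [sE tE]] := seg_meetP (in01 s01) (in01 t01); first by rewrite fs gt.
  by exists m; rewrite /= -?sE// mem_filter mb andbT hitP// -sE -tE; apply/andP.
move=> [m /=]; rewrite mem_filter hitP// => /andP[/andP[s01 t01] _] <-.
split; first by exists (param d e (shift P Q m)).
exists (zr (det2 (shift P Q m) d) / zr (det2 d e)) => //.
by apply/esym/seg_eqP; exists m; exact/(cramer _ _ _ D0).
Qed.

Hypotheses (injP : {in [pred t : R | 0 <= t <= 1] &, injective (seg P d)})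
  (injQ : {in [pred t : R | 0 <= t <= 1] &, injective (seg Q e)}).

(** Different lattice vectors give different points: since both segments are injective, the point
    determines the two parameters, and these determine the vector. *)
Lemma seg_inner_card :
  (inner_points (seg P d) `&` inner_points (seg Q e) #= `I_(size (meets P d Q e)))%card.
Proof.
pose L := meets P d Q e.
have hitL m : m \in L -> [/\ 0 < param d e (shift P Q m) < 1,
    0 < zr (det2 (shift P Q m) d) / zr (det2 d e) < 1 &
    seg P d (param d e (shift P Q m)) = seg Q e (zr (det2 (shift P Q m) d) / zr (det2 d e))].
  rewrite mem_filter hitP// => /andP[/andP[s01 t01] _]; split=> //.
  by apply/seg_eqP; exists m; exact/(cramer _ _ _ D0).
have inj m m' : m \in L -> m' \in L ->
    seg P d (param d e (shift P Q m)) = seg P d (param d e (shift P Q m')) -> m = m'.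
  move=> /hitL[s01 t01 st] /hitL[s01' t01' st'] h.
  have es := injP (in01 s01) (in01 s01') h.
  have et : zr (det2 (shift P Q m) d) / zr (det2 d e) =
      zr (det2 (shift P Q m') d) / zr (det2 d e).
    by apply: injQ; [exact: in01|exact: in01|rewrite -st -st' h].
  have cr (k : Z * Z) : let X := shift P Q k in let v := zr (det2 X d) / zr (det2 d e) in
      param d e X * zr d.1 - v * zr e.1 = zr X.1 /\ param d e X * zr d.2 - v * zr e.2 = zr X.2.
    exact/(cramer _ _ _ D0).
  have [h1 h2] := cr m; have [h1' h2'] := cr m'.
  move: h1 h2; rewrite es et h1' h2' => /eqP + /eqP; rewrite !zr_eq => /eqP e1 /eqP e2.
  by apply: (@shift_inj P Q); exact: pair_ext.
rewrite seg_inner_meets.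
have -> : [set seg P d (param d e (shift P Q m)) | m in [set` meets P d Q e]] =
    [set seg P d (param d e (shift P Q (nth 0 L i))) | i in `I_(size L)].
  apply/seteqP; split=> x [m /= mL <-].
    by exists (index m L); rewrite /= ?index_mem ?nth_index.
  by exists (nth 0 L m) => //; exact: mem_nth.
apply: inj_card_eq => j k; rewrite !inE /= => jL kL /inj jk.
have uL : uniq L by rewrite filter_uniq// allpairs_uniq// => -[? ?] [? ?].
by apply/eqP; rewrite -(nth_uniq 0 jL kL uL); apply/eqP/jk; exact: mem_nth.
Qed.

End Pair.

End IntegerSegments.

(** * Coordinates of the drawing and a decidable check of their properties *)

Definition dot2 (d X : Z * Z) : Z := d.1 * X.1 + d.2 * X.2.

(** A segment meeting itself at times [s] and [t] means [(s - t) * d = 11 * m] with [|s - t| <= 1];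
    then [m] is parallel to [d] and [11 * m] is not longer. *)
Definition simple_dir (d : Z * Z) : bool :=
  all (fun m => (m == 0) || ~~ [&& det2 d m == 0, `|11 * m.1| <= `|d.1| & `|11 * m.2| <= `|d.2|])
    box.

(** A translate of [Q] on the line has parameter [dot2 d X / dot2 d d], which has to be outside the
    open unit interval. *)
Definition avoids (P d Q : Z * Z) : bool :=
  all (fun m => let X := shift P Q m in
    [|| det2 d X != 0, dot2 d X <= 0 | dot2 d d <= dot2 d X]) box.

Definition w_pos : seq (Z * Z) := [:: (3, 3); (9, 9); (3, 6); (2, 5)].
Definition c_pos : seq (Z * Z) := [:: (9, 1); (0, 1); (8, 3)].
(* Entry number [3 i + x] is the vector of the edge from [inl i] to [inr x].  The
   coordinates were found by a computer search. *)
Definition edge_vectors : seq (Z * Z) :=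
  [:: (-5, -2); (-3, 9); (5, -11); (0, 3); (2, 3); (-1, -17);
      (-5, -16); (-14, -5); (5, 8); (-4, -4); (-13, -4); (17, 9)].

Definition edge_list : seq (nat * nat) := [seq (i, x) | i <- iota 0 4, x <- iota 0 3].
Definition tail (e : nat * nat) : Z * Z := nth 0 w_pos e.1.
Definition dir (e : nat * nat) : Z * Z := nth 0 edge_vectors (3 * e.1 + e.2).
Definition edge_meets (e f : nat * nat) := meets (tail e) (dir e) (tail f) (dir f).

Definition positions_ok : bool := all tame (w_pos ++ c_pos) && uniq (w_pos ++ c_pos).

Definition edge_ok (e : nat * nat) : bool :=
  [&& short (dir e), dir e != 0, simple_dir (dir e),
      has (fun m => shift (tail e + dir e) (nth 0 c_pos e.2) m == 0) box &
      all (avoids (tail e) (dir e)) (w_pos ++ c_pos)].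

(** Edges with different ends among the three vertices of [c_pos] are either independent or share an
    end in [W], so one parity test serves both evenness conditions. *)
Definition pair_ok (e f : nat * nat) : bool :=
  ((e != f) ==> (det2 (dir e) (dir f) != 0)) && ((e.2 != f.2) ==> ~~ odd (size (edge_meets e f))).

(* The parameters on [e], as fractions, of its inner common points with other edges. *)
Definition edge_params (e : nat * nat) : seq (nat * nat * Z * Z) :=
  [seq (f, det2 (shift (tail e) (tail f) m) (dir f), det2 (dir e) (dir f))
    | f <- [seq f <- edge_list | f != e], m <- edge_meets e f].

(** Two other edges through one inner point of [e] would give equal parameters with different edge
    labels; fractions are compared by cross-multiplication. *)
Definition triple_ok (e : nat * nat) : bool :=
  let L := edge_params e in
  allrel (fun a b => (a.1.1 == b.1.1) || (a.1.2 * b.2 != b.1.2 * a.2)) L L.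

Definition rotation_ok (i : nat) : bool :=
  [&& det2 (dir (i, 0)) (dir (i, 1)) < 0, det2 (dir (i, 1)) (dir (i, 2)) < 0 &
      det2 (dir (i, 2)) (dir (i, 0)) < 0].

Lemma drawing_ok : [&& positions_ok, all edge_ok edge_list, all rotation_ok (iota 0 4),
  allrel pair_ok edge_list edge_list & all triple_ok edge_list].
Proof. by vm_compute. Qed.

(** * The straight drawing of the complete bipartite graph *)

Section Drawing.
Context {R : realType}.
Implicit Types (e f : nat * nat) (t : R).

Local Notation zpt := (@zpt R).
Local Notation zr := (@zr R).

Lemma tail_tame e : e \in edge_list -> tame (tail e).
Proof.
have /and5P[/andP[/allP pos _] _ _ _ _] := drawing_ok.
move=> /allpairsP[p [+ _ ->]]; rewrite mem_iota add0n => /andP[_ p4].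
by apply: pos; rewrite mem_cat mem_nth.
Qed.

Lemma edgeP e : e \in edge_list -> edge_ok e.
Proof. by have /and5P[_ /allP h _ _ _] := drawing_ok; exact: h. Qed.

Lemma zvec_neq0 (d : Z * Z) : d != 0 -> zpt d <> 0.
Proof.
move=> d0 /pair_equal_spec[h1 h2]; move/eqP: d0; apply; apply: pair_ext => /=.
  by apply/eqP; rewrite -(zr_eq (R := R)); apply/eqP; rewrite zr0; lra.
by apply/eqP; rewrite -(zr_eq (R := R)); apply/eqP; rewrite zr0; lra.
Qed.

(** Coordinates from 0 to 10 in units of 1 / 11 lie in a fundamental domain of the lattice. *)
Lemma proj_zpt_inj (P Q : Z * Z) : tame P -> tame Q -> proj (zpt P) = proj (zpt Q) -> P = Q.
Proof.
move=> tP tQ PQ.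
have : seg (R := R) P 0 0 = seg Q 0 0 by rewrite /seg !line0.
move=> /seg_eqP[m] /=; rewrite !mul0r subrr -zr0 => -[/eqP + /eqP].
rewrite !zr_eq /shift /= => /eqP h1 /eqP h2; move: tP tQ; rewrite /tame => /and4P[? ? ? ?] /and4P[? ? ? ?].
by apply: pair_ext; lia.
Qed.

Lemma seg_injective P d : tame P -> short d -> d != 0 -> simple_dir d ->
  {in [pred t : R | 0 <= t <= 1] &, injective (seg P d)}.
Proof.
move=> tP sd d0 /allP simple s t; rewrite !inE => s01 t01 /seg_eqP[m [h1 h2]].
have mb := shift_box tP tP sd sd s01 t01 h1 h2.
have X1 : (shift P P m).1 = 11 * m.1 by rewrite /shift /= subrr add0r.
have X2 : (shift P P m).2 = 11 * m.2 by rewrite /shift /= subrr add0r.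
rewrite -mulrBl X1 in h1; rewrite -mulrBl X2 in h2.
have norm_zr n : `|zr n| = zr `|n|.
  by rewrite /zr -intr_norm; congr (_%:~R); lia.
have st : `|s - t| <= 1 by move: s01 t01 => /andP[? ?] /andP[? ?]; rewrite ler_norml; lra.
have small (k n : Z) : (s - t) * zr k = zr (11 * n) -> `|11 * n| <= `|k|.
  by move=> h; rewrite -(zr_le (R := R)) -!norm_zr -h normrM ler_piMl.
have := simple m mb; rewrite (small _ _ h1) (small _ _ h2) !andbT.
have -> : det2 d m == 0.
  have : zr (11 * det2 d m) = 0.
    rewrite (_ : 11 * _ = d.1 * (11 * m.2) - d.2 * (11 * m.1)); last by rewrite /det2; ring.
    by rewrite zrB !(zrM _ (11 * _)) -h1 -h2; ring.
  by rewrite -zr0 => /eqP; rewrite zr_eq; lia.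
rewrite orbF => /eqP m0; move: h1 h2; rewrite m0 /= mulr0 zr0 => /eqP + /eqP.
rewrite !mulf_eq0 subr_eq0 => /orP[/eqP//|d1] /orP[/eqP//|d2].
by case/eqP: d0; apply: pair_ext; apply/eqP; rewrite -(zr_eq (R := R)).
Qed.

Lemma seg_avoids P d Q t : tame P -> tame Q -> short d -> d != 0 -> avoids P d Q ->
  0 < t < 1 -> seg P d t <> proj (zpt Q).
Proof.
move=> tP tQ sd d0 /allP av t01 h.
have /seg_eqP[m [h1 h2]] : seg P d t = seg Q d 0 by rewrite h /seg line0.
have mb : m \in box by apply: (shift_box tP tQ sd sd (in01 t01) _ h1 h2); rewrite lexx ler01.
move: h1 h2 (av m mb); set X := shift P Q m; rewrite !mul0r !subr0 => h1 h2 /=.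
have -> /= : det2 d X == 0.
  by rewrite -(zr_eq (R := R)) zr_det /det2 /= -h1 -h2 zr0; apply/eqP; ring.
have dX : zr (dot2 d X) = t * zr (dot2 d d).
  by rewrite /dot2 !zrD !zrM -h1 -h2; ring.
have dd : 0 < zr (dot2 d d).
  rewrite -zr0 zr_lt lt_neqAle eq_sym paddr_eq0 -?expr2 ?sqr_ge0// !sqrf_eq0.
  rewrite addr_ge0 ?sqr_ge0// andbT; apply: contra d0 => /andP[/eqP e1 /eqP e2].
  by apply/eqP/pair_ext.
have /andP[t0 t1] := t01.
rewrite -!(zr_le (R := R)) dX zr0 pmulr_lle0// leNgt t0 /=.
by rewrite -[leLHS]mul1r ler_pM2r// leNgt t1.
Qed.

Local Notation V := ('I_4 + 'I_3)%type.

Definition bipartite : rel V := fun u v =>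
  match u, v with inl _, inr _ | inr _, inl _ => true | _, _ => false end.

(** Both directions of an edge have the same label. Non-edges get the label of an existing edge, so
    that [base_edge] holds for all pairs. *)
Definition base (u v : V) : nat * nat :=
  match u, v with
  | inl i, inr x | inr x, inl i => (nat_of_ord i, nat_of_ord x)
  | _, _ => (0, 0)
  end%N.

Definition vertex (v : V) : Z * Z :=
  match v with inl i => nth 0 w_pos i | inr x => nth 0 c_pos x end.

Definition edge_curve (u v : V) : R -> torus R :=
  let P := zpt (tail (base u v)) in let d := zpt (dir (base u v)) in
  if u is inl _ then line P d else line (P + d) (- d).

Lemma base_edge u v : base u v \in edge_list.
Proof.
have h (i : 'I_4) (x : 'I_3) : (nat_of_ord i, nat_of_ord x) \in edge_list.
  by apply/allpairsP; exists (nat_of_ord i, nat_of_ord x); rewrite !mem_iota /= !ltn_ord.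
by case: u v => [i|x] [j|y]; rewrite /base; [exact: (h 0 0)|exact: h|exact: h|exact: (h 0 0)].
Qed.

Lemma base_distinct u v x y : bipartite u v -> bipartite x y -> distinct_edges u v x y ->
  base u v != base x y.
Proof.
move=> uv xy; apply: contra => /eqP; case: u v uv => [i|i] [j|j] //= _;
  case: x y xy => [k|k] [l|l] //= _ [/val_inj -> /val_inj ->] //; 
  by rewrite (perm_catC [:: _]).
Qed.

Lemma base_sym u v : base v u = base u v.
Proof. by case: u v => [?|?] [?|?]. Qed.

Lemma base_independent u v x y : bipartite u v -> bipartite x y -> independent_edges u v x y ->
  (base u v).2 != (base x y).2.
Proof.
move=> uv xy; apply: contraTN => /eqP; rewrite /independent_edges disjoint_has.
by case: u v uv => [i|i] [j|j] //= _; case: x y xy => [k|k] [l|l] //= _ /val_inj ->;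
  rewrite !inE !eqxx ?orbT.
Qed.

Lemma zptD P Q : zpt (P + Q) = zpt P + zpt Q.
Proof. by apply: pair_ext; rewrite /= zrD mulrDl. Qed.

Lemma det2_zpt (a b : Z * Z) : det2 (zpt a) (zpt b) = zr (det2 a b) / 121.
Proof. by rewrite zr_det /det2 /=; field. Qed.

Lemma vertex_tame v : tame (vertex v).
Proof.
have /and5P[/andP[/allP pos _] _ _ _ _] := drawing_ok.
by case: v => [i|x]; apply: pos; rewrite mem_cat mem_nth ?orbT ?ltn_ord.
Qed.

Lemma vertex_inj : injective vertex.
Proof.
have /and5P[/andP[_ uW] _ _ _ _] := drawing_ok.
pose code (v : V) : nat := match v with inl i => i | inr x => 4 + x end%N.
have code_lt v : (code v < size (w_pos ++ c_pos))%N.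
  by case: v => [i|x] /=; [apply: leq_trans (ltn_ord i) _|rewrite ltn_add2l ltn_ord].
have vE v : vertex v = nth 0 (w_pos ++ c_pos) (code v).
  by case: v => [i|x]; rewrite nth_cat /= ?ltn_ord// addKn.
move=> u v; rewrite !vE => /eqP; rewrite nth_uniq// => /eqP.
case: u v => [i|x] [j|y] /= h; first by congr inl; exact: val_inj.
- by have := ltn_ord i; rewrite h ltnNge leq_addr.
- by have := ltn_ord j; rewrite -h ltnNge leq_addr.
- by congr inr; apply/val_inj/eqP; rewrite -(eqn_add2l 4); apply/eqP.
Qed.

Lemma pos_injective : injective (fun v : V => proj (zpt (vertex v))).
Proof. by move=> u v /(proj_zpt_inj (vertex_tame u) (vertex_tame v))/vertex_inj. Qed.

Lemma edge_head (i : 'I_4) (x : 'I_3) (e := base (inl i) (inr x)) :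
  proj (zpt (tail e) + zpt (dir e)) = proj (zpt (vertex (inr x))).
Proof.
have /and5P[_ _ _ /hasP[m _ /eqP/pair_equal_spec[h1 h2]] _] := edgeP (base_edge (inl i) (inr x)).
have key (a b k : Z) : b - a + 11 * k = 0 -> zr a / 11 = zr b / 11 + zr k.
  move=> /(congr1 zr); rewrite !zrD zrN zrM (zr_nat 11) zr0 => h; lra.
by rewrite -zptD; apply/zlatP; exists m; apply: pair_ext; exact: key.
Qed.

Lemma edge_curve_rev u v t : bipartite u v -> edge_curve v u t = edge_curve u v (1 - t).
Proof.
rewrite /edge_curve (base_sym u v); case: u v => [i|i] [j|j] //= _.
  by rewrite line_reverse.
by rewrite line_reverse subKr.
Qed.

Lemma edge_curveE u v : edge_curve u v =
  if u is inl _ then seg (tail (base u v)) (dir (base u v))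
  else fun t => seg (tail (base u v)) (dir (base u v)) (1 - t).
Proof.
by rewrite /edge_curve; case: u => i //; apply/funext => t; rewrite line_reverse.
Qed.

Lemma inner_edge_curve u v :
  inner_points (edge_curve u v) = inner_points (seg (tail (base u v)) (dir (base u v))).
Proof.
rewrite edge_curveE; case: u => // x; apply/seteqP; split=> p [t /andP[t0 t1] <-].
  by exists (1 - t) => //=; apply/andP; split; lra.
by exists (1 - t); rewrite /= ?subKr//; apply/andP; split; lra.
Qed.

Lemma curve_points_edge_curve u v :
  curve_points (edge_curve u v) = curve_points (seg (tail (base u v)) (dir (base u v))).
Proof.
rewrite edge_curveE; case: u => // x; apply/seteqP; split=> p [t /andP[t0 t1] <-].
  by exists (1 - t) => //=; apply/andP; split; lra.
by exists (1 - t); rewrite /= ?subKr//; apply/andP; split; lra.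
Qed.

Lemma edge_seg_injective e : e \in edge_list ->
  {in [pred t : R | 0 <= t <= 1] &, injective (seg (tail e) (dir e))}.
Proof.
move=> he; have /and5P[? ? ? _ _] := edgeP he.
by apply: seg_injective => //; exact: tail_tame.
Qed.

Lemma edge_pair e f : e \in edge_list -> f \in edge_list -> pair_ok e f.
Proof. by have /and5P[_ _ _ /allrelP h _] := drawing_ok; exact: h. Qed.

Lemma crossings_edge_curves u v x y : base u v != base x y ->
  crossings (edge_curve u v) (edge_curve x y) =
  inner_points (seg (tail (base u v)) (dir (base u v))) `&`
  inner_points (seg (tail (base x y)) (dir (base x y))).
Proof.
move=> uvxy; rewrite -!inner_edge_curve.
have := edge_pair (base_edge u v) (base_edge x y); rewrite /pair_ok uvxy /= => /andP[D _].
have D0 : det2 (zpt (dir (base u v))) (zpt (dir (base x y))) != 0.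
  by rewrite det2_zpt mulf_neq0 ?invr_neq0 ?pnatr_eq0// -zr0 zr_eq.
have detN (a b : R * R) : (det2 (- a) b = - det2 a b) * (det2 a (- b) = - det2 a b).
  by rewrite /det2 /=; split; ring.
rewrite /edge_curve; case: u {uvxy D} D0 => i; case: x => k D0;
  by apply: crossings_lines; rewrite ?detN ?oppr_eq0.
Qed.

Lemma edge_curve_injective u v : {in [pred t : R | 0 <= t <= 1] &, injective (edge_curve u v)}.
Proof.
have inj := edge_seg_injective (base_edge u v).
rewrite edge_curveE; case: u inj => i inj //= s t; rewrite !inE => /andP[? ?] /andP[? ?] /inj st.
have /(congr1 (fun r => 1 - r)) : 1 - s = 1 - t.
  by apply: st; rewrite inE; apply/andP; split; lra.
by rewrite !subKr.
Qed.

Definition torus_drawing : drawing R bipartite.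
Proof.
refine (@Drawing R V bipartite (fun v => proj (zpt (vertex v))) edge_curve pos_injective
  _ _ _ _ _ _ _ _ _).
- move=> u v _; apply: continuous_subspaceT => t; rewrite /edge_curve.
  by case: u => i; exact: line_continuous.
- by move=> u v _; exact: edge_curve_injective.
- move=> [i|x] [j|y] //= _; rewrite /edge_curve line0//.
  by rewrite -(edge_head j x) base_sym.
- move=> [i|x] [j|y] //= _; rewrite /edge_curve line1 ?edge_head//.
  by rewrite addrK.
- by move=> u v uv t _; exact: edge_curve_rev.
- move=> u v w _; rewrite inner_edge_curve => -[t t01].
  have he := base_edge u v; have /and5P[sd d0 _ _ /allP av] := edgeP he.
  apply: seg_avoids => //; [exact: tail_tame|exact: vertex_tame|].
  by apply: av; case: w => i; rewrite mem_cat mem_nth ?orbT ?ltn_ord.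
- move=> u v x y uv xy /(base_distinct uv xy) ne; rewrite !curve_points_edge_curve.
  have [he hf] := (base_edge u v, base_edge x y).
  have := edge_pair he hf; rewrite /pair_ok ne /= => /andP[D _].
  have [/and5P[? _ _ _ _] /and5P[? _ _ _ _]] := (edgeP he, edgeP hf).
  by apply: seg_meet_finite => //; exact: tail_tame.
- move=> u v x y uv xy /(base_distinct uv xy) ne.
  by rewrite crossings_edge_curves// !inner_edge_curve.
- move=> u v x y z w uv xy zw /(base_distinct uv xy) + /(base_distinct uv zw) + /(base_distinct xy zw).
  rewrite !inner_edge_curve.
  move: (base_edge u v) (base_edge x y) (base_edge z w).
  move: (base u v) (base x y) (base z w) => e f g he hf hg ef eg fg.
  apply/seteqP; split=> // p [[pe pf] pg].
  have := edge_pair he hf; rewrite /pair_ok ef /= => /andP[Df _].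
  have := edge_pair he hg; rewrite /pair_ok eg /= => /andP[Dg _].
  have [/and5P[? _ _ _ _] /and5P[? _ _ _ _] /and5P[? _ _ _ _]] := And3 (edgeP he) (edgeP hf) (edgeP hg).
  have [te tf tg] := And3 (tail_tame he) (tail_tame hf) (tail_tame hg).
  have : (inner_points (seg (tail e) (dir e)) `&` inner_points (seg (tail f) (dir f))) p by [].
  rewrite seg_inner_meets// => -[m hm pm].
  have : (inner_points (seg (tail e) (dir e)) `&` inner_points (seg (tail g) (dir g))) p by [].
  rewrite seg_inner_meets// => -[m' hm' pm'].
  have inL f' m0 : f' \in edge_list -> f' != e -> m0 \in edge_meets e f' ->
      (f', det2 (shift (tail e) (tail f') m0) (dir f'), det2 (dir e) (dir f')) \in edge_params e.
    by move=> h1 h2 h3; apply/allpairsPdep; exists f', m0; rewrite mem_filter h2.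
  (* A common inner point of [e], [f] and [g] has a single parameter on [e], which would be listed
     for both [f] and [g]. *)
  have /and5P[_ _ _ _ /allP/(_ e he)/allrelP ok] := drawing_ok.
  have := ok _ _ (inL f m hf (contra_neq esym ef) hm) (inL g m' hg (contra_neq esym eg) hm').
  rewrite /= (negbTE fg) /= => /negP; apply.
  have par f' m0 : det2 (dir e) (dir f') != 0 -> m0 \in edge_meets e f' ->
      0 <= @param R (dir e) (dir f') (shift (tail e) (tail f') m0) <= 1.
    by move=> D0; rewrite mem_filter (@hitP R)// => /andP[/andP[h _] _]; exact: in01.
  have /eqP : @param R (dir e) (dir f) (shift (tail e) (tail f) m) =
      @param R (dir e) (dir g) (shift (tail e) (tail g) m').
    have [s01 s01'] := (par f m Df hm, par g m' Dg hm').
    by apply: (edge_seg_injective he); [exact: s01|exact: s01'|exact: etrans pm (esym pm')].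
  have nz n : n != 0 -> zr n != 0 by rewrite -zr0 zr_eq.
  by rewrite /param eqr_div ?nz// -!zrM zr_eq.
Defined.

Lemma torus_drawing_even u v x y : base u v != base x y -> (base u v).2 != (base x y).2 ->
  cross_evenly (R := R) (edge_curve u v) (edge_curve x y).
Proof.
move=> ne ne2; rewrite /cross_evenly crossings_edge_curves//.
move: ne ne2; have [he hf] := (base_edge u v, base_edge x y).
move: (base u v) (base x y) he hf => e f he hf ef ef2.
have := edge_pair he hf; rewrite /pair_ok ef ef2 /= => /andP[D0 even].
exists (size (edge_meets e f))./2; rewrite even_halfK//.
have [/and5P[? _ _ _ _] /and5P[? _ _ _ _]] := (edgeP he, edgeP hf).
by apply: seg_inner_card => //; [exact: tail_tame|exact: tail_tame|
  exact: edge_seg_injective|exact: edge_seg_injective].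
Qed.

Lemma torus_drawing_rotation (i : 'I_4) :
  rotation torus_drawing (inl i) (inr 0) (inr 1) (inr 2).
Proof.
have /and5P[_ _ /allP/(_ i) rot _ _] := drawing_ok.
have /and3P[r1 r2 r3] : rotation_ok i by apply: rot; rewrite mem_iota /= ltn_ord.
have dne x : zpt (dir (base (inl i) (inr x))) <> 0.
  by apply: zvec_neq0; have /and5P[] := edgeP (base_edge (inl i) (inr x)).
have neg a b : det2 a b < 0 -> det2 (zpt a) (zpt b) < 0.
  by move=> h; rewrite det2_zpt pmulr_llt0 ?invr_gt0// -zr0 zr_lt.
split=> //; apply: clockwise_lines; [exact: dne|exact: dne|exact: dne|..].
- exact: neg.
- exact: neg.
- exact/ltW/neg.
Qed.

(** The edges at the four vertices [inl i] would be coherent tripods. That edges to different [inr]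
    vertices meet only in a common start is seen by distinguishing ends and inner points of both
    edges. *)
Lemma torus_drawing_not_embeddable (D' : drawing R bipartite) : embedding D' ->
  ~ forall i, same_rotation torus_drawing D' (inl i).
Proof.
move=> emb same.
have E i x : bipartite (inl i) (inr x) by [].
apply: (@no_coherent_tripods R (fun i => pos D' (inl i)) (fun x => pos D' (inr x))
  (fun i x => curve D' (inl i) (inr x))).
+ by move=> i x; exact: curve_continuous.
+ by move=> i x; exact: curve_start.
+ by move=> i x; exact: curve_end.
+ by move=> i x /pos_inj.
+ move=> i j x y s t xy /andP[s0 s1] /andP[t0 t1] st.
  have avoid k z r v : 0 < r < 1 -> curve D' (inl k) (inr z) r <> pos D' v.
    by move=> r01 h; apply: (curve_avoids_vertices (d := D') (w := v) (E k z)); exists r.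
  have [s_0|s_0] := eqVneq s 0; have [t_0|t_0] := eqVneq t 0.
  * by move: st; rewrite s_0 t_0 !curve_start// => /pos_inj[->].
  * have [t_1|t_1] := eqVneq t 1.
      by move: st; rewrite s_0 t_1 curve_start// curve_end// => /pos_inj.
    case: (avoid j y t (inl i)); first by rewrite !lt_neqAle eq_sym t_0 t0 t_1 t1.
    by rewrite -st s_0 curve_start.
  * have [s_1|s_1] := eqVneq s 1.
      by move: st; rewrite t_0 s_1 curve_start// curve_end// => /pos_inj.
    case: (avoid i x s (inl j)); first by rewrite !lt_neqAle eq_sym s_0 s0 s_1 s1.
    by rewrite st t_0 curve_start.
  * have [s_1|s_1] := eqVneq s 1; have [t_1|t_1] := eqVneq t 1.
    - move: st; rewrite s_1 t_1 !curve_end// => /pos_inj[xy'].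
      by rewrite xy' eqxx in xy.
    - case: (avoid j y t (inr x)); first by rewrite !lt_neqAle eq_sym t_0 t0 t_1 t1.
      by rewrite -st s_1 curve_end.
    - case: (avoid i x s (inr y)); first by rewrite !lt_neqAle eq_sym s_0 s0 s_1 s1.
      by rewrite st t_1 curve_end.
    - have ne : distinct_edges (inl i : 'I_4 + 'I_3) (inr x) (inl j) (inr y).
        apply/negP => /perm_mem/(_ (inr x)); rewrite !inE eqxx orbT /=.
        by move=> /esym/eqP[xy']; rewrite xy' eqxx in xy.
      (* A common inner point would be a crossing, since edges do not touch, and an embedding has no
         crossings. *)
      have := curves_no_touching (d := D') (E i x) (E j y) ne.
      rewrite (emb _ _ _ _ (E i x) (E j y) ne) => /(_ (curve D' (inl i) (inr x) s))[]; split.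
        by exists s => //=; rewrite !lt_neqAle eq_sym s_0 s0 s_1 s1.
      by exists t; rewrite //= !lt_neqAle eq_sym t_0 t0 t_1 t1.
+ by move=> i; have [_ _ _] := (same i _ _ _).1 (torus_drawing_rotation i).
Qed.

End Drawing.

Local Close Scope quotient_scope.
Local Close Scope ring_scope.
Local Close Scope classical_set_scope.

Theorem theorem7 (R : realType) :
  exists (V : finType) (E : rel V), symmetric E /\ irreflexive E /\
  exists (D : drawing R E) (W : {set V}),
    [/\ #|W| = 4,
        independently_even D,
        (forall w, w \in W -> even_at D w) &
        ~ exists D' : drawing R E,
            embedding D' /\ (forall w, w \in W -> same_rotation D D' w)].
Proof.
exists ('I_4 + 'I_3)%type, bipartite; split; [|split].
- by case=> [?|?] [?|?].
- by case.
exists (torus_drawing (R := R)), (imset inl (mem 'I_4)); split.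
- by rewrite card_imset ?card_ord// => i j [].
- move=> u v x y uv xy ind; have ne := base_independent uv xy ind.
  by apply: torus_drawing_even => //; apply: contraNneq ne => ->.
- move=> _ /imsetP[i _ ->] [a|a] [b|b] //= _ _ ab.
  have ne : (base (inl i) (inr a)).2 != (base (inl i) (inr b)).2.
    by apply: contraNneq ab => /val_inj ->.
  apply: (@torus_drawing_even R (inl i) (inr a) (inl i) (inr b)) => //.
  by apply: contraNneq ne => ->.
- move=> [D' [emb same]]; apply: (torus_drawing_not_embeddable emb) => i.
  by apply: same; apply/imsetP; exists i.
Qed.
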